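(* Let $n\ge 2$, $m\in\mathbb{Z}$, let $w\in W$, and let $\mathcal{C}_w(L_m)$ be the Demazure crystal generated from $L_m$ according to a reduced word $w=s_{i_1}\cdots s_{i_t}$. Then $$\mathcal{C}_w(L_m)=\{\,J\in\mathcal{C}(L_m)\ \mid\ \mathrm{roof}(J)\le w(L_m)\,\},$$ where $\le$ is the parabolic Bruhat order on subsets of $\mathbb{Z}$.
   Context: Fix an integer $n\ge 2$. **Sets.** $\mathcal{T}$ is the collection of all $J\subset\mathbb{Z}$ such that $J\setminus\mathbb{Z}_{\le0}$ and $\mathbb{Z}_{\le0}\setminus J$ are both finite. Write $J=\{\cdots<j_{-2}<j_{-1}<j_0\}$. The order of $J$ is $\mathrm{ord}(J)=|J\setminus\mathbb{Z}_{\le0}|-|\mathbb{Z}_{\le0}\setminus J|$; thus $\mathrm{ord}(J)=m$ iff $j_i=m+i$ for all $i\ll0$. $J$ is $n$-bounded if $j_i-j_{i-1}\le n$ for all $i$; $J$ is $n$-stable if $j-n\in J$ for all $j\in J$. For $m\in\mathbb{Z}$ let $L_m=\mathbb{Z}_{\le m}$ and $\mathcal{C}(L_m)=\{J\in\mathcal{T}\mid \mathrm{ord}(J)=m,\ J\text{ is }n\text{-bounded}\}$. Notation: $J\setminus p\cup q:=(J\setminus\{p\})\cup\{q\}$. **Weyl group.** For $i=0,\dots,n-1$, $s_i:\mathbb{Z}\to\mathbb{Z}$ is the product of the commuting transpositions $(i+nk,\ i+1+nk)$, $k\in\mathbb{Z}$. $W=\langle s_0,\dots,s_{n-1}\rangle$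 is the corresponding Coxeter group (the affine Weyl group of type $A^{(1)}_{n-1}$). It acts on $\mathcal{T}$ by $w(J)=\{w(j)\mid j\in J\}$. **Parabolic Bruhat order.** For $K=\{\cdots<k_{-1}<k_0\}$ and $J=\{\cdots<j_{-1}<j_0\}$ in $\mathcal{T}$: $K\le J$ iff $k_i\le j_i$ for all $i$ and $k_i=j_i$ for all $i\ll0$. **Crystal lowering operators.** For $J\in\mathcal{T}$ and $i\in\{0,\dots,n-1\}$, let $R$ be the set of integers $r$ such that for all $k\ge r$, $|\{j\in J: r\le j\le k,\ j\equiv i \bmod n\}|>|\{j\in J: r\le j\le k,\ j\equiv i+1\bmod n\}|$. If $R=\emptyset$ then $f_i(J)$ is undefined; otherwise $f_i(J)=J\setminus r\cup(r+1)$ with $r=\min R$. **Demazure crystal.** For a reduced word $w=s_{i_1}\cdots s_{i_t}$, $\mathcal{C}_w(L_m)=\{f_{i_1}^{k_1}\cdots f_{i_t}^{k_t}L_m\mid k_1,\dots,k_t\ge0\}$ (only those expressions that are defined). **Roof.** If $J$ is $n$-bounded but not $n$-stable, define $\mathrm{up}(J)=J\setminus p\cup q$, where $p=\max\{p'\mid p'\in J,\ p'-n\notin J\}$ and $q=\min\{q'>p\mid q'\notin J,\ q'-n\in J,\ q'\not\equiv p\bmod n\}$. Iterating $\mathrm{up}$ on $J\in\mathcal{C}(L_m)$ one reaches after finitely many steps an $n$-stable set, $\mathrm{roof}(J):=\mathrm{up}^\ell(J)$ (with $\ell=0$, $\mathrm{roof}(J)=J$, if $J$ is already $n$-stable); it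 has the form $y(L_m)$ for some $y\in W$. *)

(* Defs.v *)
From mathcomp Require Import all_boot all_order all_algebra finmap zify.
From mathcomp Require Import boolp classical_sets functions cardinality.
Set Implicit Arguments.
Unset Strict Implicit.
Unset Printing Implicit Defensive.
Import Order.TTheory GRing.Theory Num.Theory.
Local Open Scope classical_set_scope.
Local Open Scope ring_scope.

(* Maximum and minimum of a set of integers; the value is 0 when there is
   none. *)
Definition zmax (A : set int) : int :=
  xget 0 [set x | A x /\ forall y, A y -> y <= x].

Definition zmin (A : set int) : int :=
  xget 0 [set x | A x /\ forall y, A y -> x <= y].

(* Meaningful for finite A only. *)
Definition zcard (A : set int) : nat := #|` fset_set A|.

(* J \ p ∪ q *)
Definition swap (J : set int) (p q : int) : set int := (J `\ p) `|` [set q].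

Definition L (m : int) : set int := [set x | x <= m].

Definition calT : set (set int) :=
  [set J | finite_set (J `\` L 0) /\ finite_set (L 0 `\` J)].

Definition ord (J : set int) : int :=
  (zcard (J `\` L 0))%:Z - (zcard (L 0 `\` J))%:Z.

(* For J = {... < j_{-2} < j_{-1} < j_0}, [elt J k] is j_{-k}. *)
Fixpoint elt (J : set int) (k : nat) : int :=
  if k is k'.+1 then zmax (J `&` [set x | x < elt J k']) else zmax J.

Definition nbounded (n : nat) (J : set int) : Prop :=
  forall k : nat, elt J k - elt J k.+1 <= n%:Z.

Definition nstable (n : nat) (J : set int) : Prop :=
  forall j : int, J j -> J (j - n%:Z).

Definition crystal (n : nat) (m : int) : set (set int) :=
  [set J | [/\ calT J, ord J = m & nbounded n J]].

(* The product of the transpositions (i + nk, i + 1 + nk), k in Z. *)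
Definition s (n : nat) (i : 'I_n) (x : int) : int :=
  if (x == i%:Z %[mod n%:Z])%Z then x + 1
  else if (x == i%:Z + 1 %[mod n%:Z])%Z then x - 1
  else x.

Lemma sK (n : nat) (i : 'I_n) : (1 < n)%N -> involutive (s i).
Proof.
move=> n1 x; rewrite /s.
have E a b : (a == b %[mod n%:Z])%Z = (n%:Z %| a - b)%Z by rewrite eqz_mod_dvd.
have N1 : ~~ (n%:Z %| 1)%Z by rewrite dvdz1 /=; lia.
rewrite !E; case: (boolP (n%:Z %| x - i%:Z)%Z) => [d|nd].
  have -> : (n%:Z %| x + 1 - i%:Z)%Z = false.
    apply/negbTE; apply: contra N1 => d'.
    have e : x + 1 - i%:Z - (x - i%:Z) = 1 by lia.
    by have := rpredB d' d; rewrite e.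
  have -> : x + 1 - (i%:Z + 1) = x - i%:Z by lia.
  by rewrite d addrK.
case: (boolP (n%:Z %| x - (i%:Z + 1))%Z) => [d|nd'];
  last by rewrite (negbTE nd) (negbTE nd').
have -> : x - 1 - i%:Z = x - (i%:Z + 1) by lia.
by rewrite d subrK.
Qed.

Definition word_act (n : nat) (u : seq 'I_n) : int -> int :=
  foldr (fun i g => s i \o g) id u.

(* The group generated by the s i, as permutations of Z: since the s i are
   involutions ([sK]), its elements are the products of the s i. *)
Definition weyl (n : nat) : set (int -> int) :=
  [set w : int -> int | exists u : seq 'I_n, w =1 word_act u].

Definition reduced_word (n : nat) (w : int -> int) (u : seq 'I_n) : Prop :=
  w =1 word_act u /\
  forall v : seq 'I_n, w =1 word_act v -> (size u <= size v)%N.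

Definition bruhat_le (K J : set int) : Prop :=
  (forall k : nat, elt K k <= elt J k) /\
  exists N : nat, forall k : nat, (N <= k)%N -> elt K k = elt J k.

(* Number of j in J with r <= j <= k and j congruent to a modulo n. *)
Definition count_mod (n : nat) (J : set int) (r k a : int) : nat :=
  zcard [set j | [/\ J j, r <= j, j <= k & (j = a %[mod n%:Z])%Z]].

Definition lowerR (n : nat) (i : 'I_n) (J : set int) : set int :=
  [set r | forall k : int, r <= k ->
    (count_mod n J r k (i%:Z + 1) < count_mod n J r k i%:Z)%N].

(* The crystal operator f_i; [None] stands for "undefined". *)
Definition lower (n : nat) (i : 'I_n) (J : set int) : option (set int) :=
  let r := zmin (lowerR i J) in
  if `[< lowerR i J !=set0 >] then Some (swap J r (r + 1)) else None.

Definition lower_iter (n : nat) (i : 'I_n) (k : nat) (oJ : option (set int)) :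
    option (set int) :=
  iter k (obind (@lower n i)) oJ.

(* For u = [:: i_1; ...; i_t], the set of all defined
   f_{i_1}^{k_1} ... f_{i_t}^{k_t} L_m; the innermost operator is f_{i_t}. *)
Definition demazure (n : nat) (u : seq 'I_n) (m : int) : set (set int) :=
  [set J | exists ks : (size u).-tuple nat,
     foldr (fun ik oJ => lower_iter ik.1 ik.2 oJ) (Some (L m)) (zip u ks)
     = Some J].

(* Meaningful only when J is n-bounded and not n-stable. *)
Definition up (n : nat) (J : set int) : set int :=
  let p := zmax [set p' | J p' /\ ~ J (p' - n%:Z)] in
  let q := zmin [set q' | [/\ p < q', ~ J q', J (q' - n%:Z)
                            & (q' <> p %[mod n%:Z])%Z]] in
  swap J p q.

(* [is_roof n J K]: K = up^l(J), where l is the number of steps after which an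
   n-stable set is first reached. *)
Definition is_roof (n : nat) (J K : set int) : Prop :=
  exists l : nat, [/\ K = iter l (up n) J, nstable n K
    & forall l' : nat, (l' < l)%N -> ~ nstable n (iter l' (up n) J)].

(* The value is set0, which is not in calT, when no iterate is n-stable. *)
Definition roof (n : nat) (J : set int) : set int :=
  xget set0 [set K | is_roof n J K].

(* Main.v *)
Require Import Defs.
From mathcomp Require Import all_boot all_order all_algebra finmap.
From mathcomp Require Import zify.
From mathcomp Require Import boolp classical_sets functions cardinality.
Set Implicit Arguments.
Unset Strict Implicit.
Unset Printing Implicit Defensive.
Import Order.TTheory GRing.Theory Num.Theory.

(** Why the theorem holds.

    View a set J as beads placed on the integers, and the n residue classes
    modulo n as runners.  Iterating [up] on J amounts to one scan of the
    integers from right to left.  When the positions above x have been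
    treated, the current set is n-stable above x and still equal to J below,
    so it is described by the numbers h_1, ..., h_n of beads above x on the
    runners of x + 1, ..., x + n ([conf]).  A bead of J at x raises the last
    of these runners by one.  A gap of J at x leaves the beads of that runner
    without support, and [up] moves them away one by one, lowest first: the
    k-th of them lands on the lowest runner of height at least k, the nearest
    one in case of a tie.  In terms of the list of heights, this is
    [place k], and the whole move is [run 1 b] ([up_mid], [climbs_scan]).
    Thus the roof of J is the value of a recursion on lists of naturals
    ([scan], [roof_scan]).

    For a fixed i, the runners of i and i + 1 are neighbours, and everything
    that is needed about crystal operators is a statement on two adjacent
    entries of such lists.

    - If J' = f_i J, the roof of J' is the roof of J or its image under s_i
      ([roof_lowers]).  The two scans agree until the bead that f_i moves;
      there the two entries come out exchanged ([step_left_right]).  They stay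
      exchanged while the scan passes other residues ([swapped_run]) and pairs
      of two beads, and become equal at the first pair of two gaps
      ([step_neitherC]) or with a bead at i + 1 only ([step_rightC]).  A pair
      with a bead at i only cannot come before that, since f_i moves the
      leftmost unmatched bead.

    - If no bead of class i + 1 is unmatched in J, the roof K of J satisfies
      K <= s_i K ([imin_roof]): the entry of i + 1 exceeds that of i only
      after a pair with a bead at i + 1 only, whose bead is still unmatched.

    Let w = s_i v with a reduced word.  The exchange condition gives
    v(L_m) <= s_i v(L_m) ([reduced_imin]), and the Bruhat order on sets, once
    written in terms of the numbers of elements above each point
    ([bruhat_count_le]), has the two usual lifting properties
    ([count_le_imax], [count_le_lift]).  By induction on the word, an f_i-string
    starting at J_0 with roof at most v(L_m) has all its roofs at most w(L_m).
    Conversely, a set J with roof at most w(L_m) lies on an f_i-string whose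
    first element J_0 has no unmatched bead of class i + 1 ([raise]); its roof
    is at most w(L_m) by the first item and at most v(L_m) by the second. *)

(** * Lists of runner heights *)

(** The entry h, with W behind it, gets the bead of level k unless some entry
    of W that can carry it is smaller; equal entries behind h lose the tie. *)
Definition receives (k h : nat) (W : seq nat) : bool :=
  (k <= h) && all (fun x => (x < k) || (h <= x)) W.

(** Entries below k cannot carry a bead of level k: on such a runner the next
    free position lies left of the bead to be moved, and [up] only moves beads
    to the right. *)
Fixpoint place (k : nat) (W : seq nat) : seq nat :=
  if W is h :: W' then
    if receives k h W' then h.+1 :: W' else h :: place k W'
  else [::].

Fixpoint run (k c : nat) (W : seq nat) : seq nat :=
  if c is c'.+1 then run k.+1 c' (place k W) else W.

(** A zero entry is an empty runner, which never receives a bead; hence the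
    exception for zero. *)
Definition tall (k : nat) (W : seq nat) : bool :=
  all (fun x => (x == 0) || (k <= x)) W.

(** The situations that occur before the bead of level k when beads are placed
    in increasing order of level. Either every nonempty runner is higher than
    k, or some entry is exactly k and the nonzero entries below k, which have
    dropped out, all lie behind the first entry k. Every list is ready for
    level 1 ([ready1]), and [ready_place] is the invariance. *)
Definition ready (k : nat) (W : seq nat) : Prop :=
  tall k.+1 W \/ exists A B, W = A ++ k :: B /\ tall k.+1 A.

Lemma size_place k W : size (place k W) = size W.
Proof. by elim: W => //= h W IH; case: ifP => //= _; rewrite IH. Qed.

Lemma size_run k c W : size (run k c W) = size W.
Proof. by elim: c k W => //= c IH k W; rewrite IH size_place. Qed.

Lemma place_eq0 k W e : 0 < k ->
  (nth 0 (place k W) e == 0) = (nth 0 W e == 0).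
Proof.
move=> k0; elim: W e => //= h W IH [|e] /=; case: ifP => //= /andP[kh _].
by lia.
Qed.

Lemma run_eq0 k c W e : 0 < k ->
  (nth 0 (run k c W) e == 0) = (nth 0 W e == 0).
Proof.
elim: c k W => //= c IH k W k0; rewrite IH //; exact: place_eq0.
Qed.

Lemma run_add k c1 c2 W : run k (c1 + c2) W = run (k + c1) c2 (run k c1 W).
Proof.
elim: c1 k W => [|c1 IH] k W /=; first by rewrite addn0.
by rewrite IH addSnnS.
Qed.

Lemma place0 k W : 0 < k -> place k (0 :: W) = 0 :: place k W.
Proof. by move=> k0 /=; rewrite /receives leqNgt k0. Qed.

Lemma run0 k c W : 0 < k -> run k c (0 :: W) = 0 :: run k c W.
Proof.
elim: c k W => // c IH k W k0.
by rewrite [LHS]/= -/(place k (0 :: W)) place0 // IH.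
Qed.

Lemma placeE k A m B : k <= m ->
  all (fun x => (x < k) || (m < x)) A ->
  all (fun x => (x < k) || (m <= x)) B ->
  place k (A ++ m :: B) = A ++ m.+1 :: B.
Proof.
move=> km + hB; elim: A => [_|a A IH] /=; first by rewrite /receives km hB.
move=> /andP[ha hA]; rewrite /receives all_cat /=.
case: ifP => [/and4P[ka _ + _]|_]; last by rewrite IH.
by lia.
Qed.

Lemma place_dead k W : all (fun x => x < k) W -> place k W = W.
Proof.
elim: W => //= h W IH /andP[hk hW]; rewrite /receives leqNgt hk /=.
by rewrite IH.
Qed.

Lemma placeP k W : all (fun x => x < k) W \/
  exists A m B, [/\ W = A ++ m :: B, k <= m,
    all (fun x => (x < k) || (m < x)) A &
    all (fun x => (x < k) || (m <= x)) B].
Proof.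
elim: W => [|h W [dW|[A [m [B [-> km hA hB]]]]]] /=; first by left.
  case: (ltnP h k) => hk; first by left.
  right; exists [::], h, W; split=> //.
  by apply: sub_all dW => x ->.
right; case: (boolP ((h < k) || (m < h))) => hh.
  by exists (h :: A), m, B; split=> //=; rewrite hh.
exists [::], h, (A ++ m :: B); split=> //; first by lia.
rewrite all_cat /=; apply/and3P; split; last first.
- by apply: sub_all hB => x; lia.
- by lia.
- by apply: sub_all hA => x; lia.
Qed.

Lemma tall_cat k A B : tall k (A ++ B) = tall k A && tall k B.
Proof. exact: all_cat. Qed.

Lemma tall_sub j k W : j <= k -> tall k W -> tall j W.
Proof. by move=> jk; apply: sub_all => x; lia. Qed.

Lemma tall_place j k W : 0 < j -> tall k W -> tall k (place j W).
Proof.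
move=> j0; elim: W => //= h W IH /andP[hh hW]; case: ifP => [/andP[jh _]|_] /=.
  by apply/andP; split=> //; lia.
by rewrite hh; apply: IH.
Qed.

Lemma tall_run j c k W : 0 < j -> tall k W -> tall k (run j c W).
Proof. by elim: c j W => //= c IH j W j0 hW; apply/IH/tall_place. Qed.

Lemma tall_ready k W : tall k W -> ready k W.
Proof.
elim: W => [|h W IH] /=; first by left.
move=> /andP[hh hW].
have [e|nk] := eqVneq h k; first by right; exists [::], W; rewrite e.
have hh' : (h == 0) || (k < h) by lia.
case: (IH hW) => [b|[A [B [-> b]]]].
  by left => /=; rewrite hh'.
by right; exists (h :: A), B; rewrite /= hh'.
Qed.

Lemma ready1 W : ready 1 W.
Proof. by apply: tall_ready; elim: W => //= h W ->; rewrite andbT; lia. Qed.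

Lemma tall_place_min k X B : tall k.+1 X -> tall k B -> 0 < k ->
  forall j, 0 < j <= k -> place j (X ++ k :: B) = X ++ k.+1 :: B.
Proof.
move=> bX bB k0 j jk; apply: placeE; first by lia.
  by apply: sub_all bX => x; lia.
by apply: sub_all bB => x; lia.
Qed.

Lemma place_tight k A B : 0 < k -> tall k.+1 A ->
  place k (A ++ k :: B) = A ++ k.+1 :: B.
Proof.
move=> k0 bA; apply: placeE => //; first by apply: sub_all bA => x; lia.
by apply/allP => x _; lia.
Qed.

Lemma place_tall j k W : 0 < j <= k -> tall k W -> place j W = place 1 W.
Proof.
move=> jk; elim: W => //= h W IH /andP[hh hW]; rewrite IH //.
congr (if _ then _ else _); rewrite /receives.
have -> : (j <= h) = (1 <= h) by lia.
case: (ltnP 0 h) => //= h0; apply: eq_in_all => x /(allP hW); lia.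
Qed.

Lemma ready_tight k A B : tall k A -> ready k (A ++ k :: B).
Proof.
move=> /tall_ready[b|[A1 [A2 [-> b]]]]; right.
  by exists A, B.
by exists A1, (A2 ++ k :: B); rewrite -catA.
Qed.

Lemma ready_place k W : 0 < k -> ready k W -> ready k.+1 (place k W).
Proof.
move=> k0 [b|[A [B [-> b]]]]; first exact/tall_ready/tall_place.
by rewrite place_tight //; apply: ready_tight.
Qed.

Lemma ready_run k c W : 0 < k -> ready k W -> ready (k + c) (run k c W).
Proof.
elim: c k W => [|c IH] k W k0 iW /=; first by rewrite addn0.
by rewrite -addSnnS; apply: IH => //; apply: ready_place.
Qed.

(** From an entry k on, the beads of levels k, k + 1, ... stay on the highest
    level: each goes to the entry just raised or to an equal one in front of
    it, so nothing behind the first entry k is touched. *)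
Lemma run_tight k c A B : 0 < k -> tall k.+1 A ->
  run k c (A ++ k :: B) = run k c (A ++ [:: k]) ++ B.
Proof.
elim: c k A B => [|c IH] k A B k0 bA; first by rewrite /= -catA.
rewrite /= !place_tight //.
case: (tall_ready bA) => [b|[A1 [A2 [-> b]]]]; first exact: IH.
rewrite -!catA !cat_cons (IH k.+1 A1) // (IH k.+1 A1 (A2 ++ _)) //.
by rewrite -!catA.
Qed.

(** When no runner has dropped out, one extra bead placed freely can be placed
    before or after the others. The two orders differ only if two entries are
    equal to k: the later of them then either is raised by the extra bead
    first, or drops out and is raised by it at the end, and [run_tight] shows
    that the other beads do not notice. *)
Lemma place1_run k c W : 0 < k -> tall k W ->
  place 1 (run k c W) = run k c (place 1 W).
Proof.
elim: c k W => //= c IH k W k0 bW.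
have eP V : tall k V -> place k V = place 1 V by apply: place_tall; lia.
rewrite !eP ?tall_place //.
case: (tall_ready bW) => [b|[A [B [eW bA]]]]; first by rewrite IH ?tall_place.
have bB : tall k B by move: bW; rewrite eW tall_cat => /and3P[].
have -> : place 1 W = A ++ k.+1 :: B by rewrite eW tall_place_min.
have bA1 : tall k.+1 (rcons A k.+1).
  by rewrite -cats1 tall_cat bA /= ltnSn.
case: (tall_ready bB) => [b|[B1 [B2 [eB bB1]]]].
  by rewrite IH // tall_cat bA /= ltnSn b.
(* Two entries are equal to k, separated by B1: on the right both are raised
   at the start, on the left the second one is raised at the end. *)
rewrite eB.
have eY X : A ++ k.+1 :: B1 ++ X = (rcons A k.+1 ++ B1) ++ X.
  by rewrite -cats1 -!catA.
have bX : tall k.+1 (rcons A k.+1 ++ B1) by rewrite tall_cat bA1.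
have bB2 : tall k B2 by move: bB; rewrite eB tall_cat => /and3P[].
have -> : place 1 (A ++ k.+1 :: B1 ++ k :: B2) =
    (rcons A k.+1 ++ B1) ++ k.+1 :: B2.
  by rewrite eY tall_place_min.
have [A1 [A2 [eA bA2]]] : exists A1 A2, rcons A k.+1 = A1 ++ k.+1 :: A2 /\
    tall k.+2 A1.
  case: (tall_ready bA) => [b|[A1 [A2 [-> b]]]].
    by exists A, [::]; rewrite cats1.
  by exists A1, (rcons A2 k.+1); rewrite rcons_cat.
rewrite eY eA -!catA !cat_cons (run_tight c (A2 ++ B1 ++ k :: B2)) //.
rewrite (run_tight c (A2 ++ B1 ++ k.+1 :: B2)) //.
rewrite !catA tall_place_min // -!catA !tall_cat.
rewrite tall_run ?tall_cat //=; last by rewrite (tall_sub _ bA2) ?leqnn ?orbT.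
by move: bX; rewrite eA !tall_cat /= => /andP[/and3P[_ _ ->] ->].
Qed.

Lemma place_cat_skip j k X B : 0 < j <= k -> tall k X ->
  has (fun x => (j <= x) && (x < k)) B -> place j (X ++ B) = X ++ place j B.
Proof.
move=> jk bX hB; elim: X bX => //= h X IH /andP[hh bX].
case: ifP => [/andP[jh]|_]; last by rewrite IH.
rewrite all_cat => /andP[_ /allP aB]; case/hasP: hB => x /aB; lia.
Qed.

Lemma not_tall k A B : tall k.+1 A -> ~~ tall k (A ++ k :: B) ->
  has (fun x => (x != 0) && (x < k)) B.
Proof.
move=> bA; rewrite tall_cat (tall_sub _ bA) //= leqnn orbT /= => /allPn[x xB].
by rewrite negb_or -ltnNge => h; apply/hasP; exists x.
Qed.

Lemma ready_alive j k A B : 0 < j -> j < k -> tall k.+1 A ->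
  ready j (A ++ k :: B) -> ~~ tall k (A ++ k :: B) -> has (fun x => (j <= x) && (x < k)) B.
Proof.
move=> j0 jk bA iW nb; have /hasP[x xB xk] := not_tall bA nb.
case: iW => [bj|[A' [B' [e _]]]].
  apply/hasP; exists x => //; move/allP: bj => /(_ x).
  by rewrite mem_cat in_cons xB !orbT => /(_ isT); lia.
have : j \in A ++ k :: B by rewrite e mem_cat mem_head orbT.
rewrite mem_cat in_cons; case/or3P => [jA|/eqP|jB]; last 2 first.
- by lia.
- by apply/hasP; exists j => //; rewrite leqnn jk.
by move/allP: bA => /(_ _ jA); lia.
Qed.

(** A bead of level j below k looks at entries below k if there are any, and
    those lie out of reach of the beads of levels from k on; otherwise it is
    placed freely and [place1_run] applies. *)
Lemma place_run_comm j k c W : 0 < j -> j < k -> ready k W -> ready j W ->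
  run k c (place j W) = place j (run k c W).
Proof.
move=> j0 jk iW jW; have k0 : 0 < k by lia.
case: (boolP (tall k W)) => [bW|nb].
  have jk' : 0 < j <= k by lia.
  by rewrite !(place_tall jk') ?tall_run // place1_run.
case: iW nb jW => [b|[A [B [-> bA]]]] nb jW.
  by rewrite (tall_sub _ b) in nb.
have hB := ready_alive j0 jk bA jW nb.
have bX : tall k (A ++ [:: k]).
  by rewrite tall_cat (tall_sub _ bA) //= leqnn orbT.
have jk' : 0 < j <= k by lia.
rewrite (run_tight c B) // (place_cat_skip jk' (tall_run c k0 bX)) //.
rewrite -run_tight //.
by rewrite -cat1s catA (place_cat_skip jk') // -catA.
Qed.

Lemma ready_place_lt j k W : 0 < j -> j < k -> ready k W -> ready j W ->
  ready k (place j W).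
Proof.
move=> j0 jk iW jW.
case: (boolP (tall k W)) => [bW|nb]; first exact/tall_ready/tall_place.
case: iW nb jW => [b|[A [B [-> bA]]]] nb jW.
  by rewrite (tall_sub _ b) in nb.
have hB := ready_alive j0 jk bA jW nb.
have bX : tall k (A ++ [:: k]).
  by rewrite tall_cat (tall_sub _ bA) //= leqnn orbT.
have jk' : 0 < j <= k by lia.
rewrite -cat1s catA (place_cat_skip jk') // -catA cat1s.
by right; exists A, (place j B).
Qed.

Lemma run_comm_gen j l k c W : 0 < j -> j + l <= k -> ready k W -> ready j W ->
  run k c (run j l W) = run j l (run k c W).
Proof.
elim: l j W => //= l IH j W j0 jl iW jW.
have jk : j < k by lia.
rewrite IH //; first by rewrite (place_run_comm c j0 jk iW jW).
- by rewrite addSnnS.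
- exact: ready_place_lt.
- exact: ready_place.
Qed.

(** Two unsupported columns can be dispersed in either order: after as many
    beads as the shorter one has, the remaining beads of the longer one have
    higher levels than all beads of the other dispersal, and commute with them
    by [place_run_comm]. *)
Lemma run1_comm a b W : run 1 a (run 1 b W) = run 1 b (run 1 a W).
Proof.
wlog ab : a b / a <= b => [H|].
  by case: (leqP a b) => ab; [|symmetry]; apply: H => //; apply: ltnW.
rewrite -(subnKC ab) !run_add.
rewrite (@run_comm_gen 1 a (1 + a) _ (run 1 a W)) //; last exact: ready1.
by apply: ready_run => //; apply: ready1.
Qed.

Lemma run_tall k c k' W : 0 < k -> 0 < k' -> tall (k + c).-1 W ->
  tall (k' + c).-1 W -> run k c W = run k' c W.
Proof.
elim: c k k' W => //= c IH k k' W k0 k0' b b'.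
rewrite (place_tall _ b); last by lia.
rewrite (place_tall _ b'); last by lia.
apply: IH => //; apply: tall_place => //.
  by move: b; rewrite addnS.
by move: b'; rewrite addnS.
Qed.

Lemma place_rcons_last k W A : k <= A ->
  all (fun x => (x < k) || (A < x)) W -> place k (rcons W A) = rcons W A.+1.
Proof. by move=> kA aW; rewrite -!cats1 placeE. Qed.

Lemma place_rcons k W A :
  (A < k) || has (fun x => (k <= x) && (x <= A)) W ->
  place k (rcons W A) = rcons (place k W) A.
Proof.
move=> h; case: (placeP k W) => [dW|[A' [m [B [eW km hA hB]]]]].
  rewrite !place_dead // all_rcons dW andbT; case/orP: h => // /hasP[x].
  by move/(allP dW); lia.
rewrite eW placeE // rcons_cat rcons_cons placeE // ?rcons_cat //.
rewrite all_rcons hB andbT; case/orP: h => [->//|/hasP[x]].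
rewrite eW mem_cat in_cons => /or3P[/(allP hA)|/eqP|/(allP hB)]; lia.
Qed.

Lemma no_alive (P Q : pred nat) W : ~~ has P W ->
  (forall x, ~~ P x -> Q x) -> all Q W.
Proof. by move=> /hasPn h PQ; apply/allP => x /h /PQ. Qed.

Lemma ready_tall k p W : 0 < k -> ready k W ->
  ~~ has (fun x => (k <= x) && (x <= k + p)) W -> tall (k + p).+1 W.
Proof.
move=> k0 [b|[A [B [-> _]]]] h.
  apply/allP => x xW; move/allP: b => /(_ x xW).
  by move/hasPn: h => /(_ x xW); lia.
by case/negP: h; rewrite has_cat /= leqnn leq_addr orbT.
Qed.

(** A runner A at the end of the list can serve as intermediate storage:
    dispersing what it finally holds is the same as dispersing the beads it
    held at the start after all others. A bead can be stored on A only while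
    all other nonempty runners are higher than A, so its level does not
    matter. *)
Lemma run_rcons k c W A : 0 < k -> ready k W ->
  exists W' A', run k c (rcons W A) = rcons W' A' /\
    run 1 A' W' = run 1 A (run k c W).
Proof.
elim: c k W A => [|c IH] k W A k0 iW; first by exists W, A.
have iW' := ready_place k0 iW.
case: (boolP ((A < k) || has (fun x => (k <= x) && (x <= A)) W)) => h.
  by rewrite /= place_rcons //; apply: IH.
move: h; rewrite negb_or -leqNgt => /andP[kA h].
rewrite [run k c.+1 _]/= place_rcons_last //; last first.
  by apply: no_alive h _ => x; lia.
(* The bead is stored on A, so every nonempty runner of W is higher. *)
have bW : tall A.+1 W.
  by rewrite -(subnKC kA); apply: ready_tall => //; rewrite subnKC.
have bW1 : tall k.+1 W by apply: tall_sub bW; lia.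
have [W' [A' [-> e]]] := IH k.+1 W A.+1 isT (tall_ready bW1).
exists W', A'; split; rewrite // e [run 1 A.+1 _]/= [run k _ _]/=.
rewrite (@place_tall k k.+1 W) ?k0 //= -(@place1_run k.+1 c W) //.
apply: run_tall => //; rewrite ?add2n ?add1n /=; apply/tall_place/tall_run => //.
exact: tall_sub bW.
Qed.

(** A runner that loses all ties at height A behaves like one that wins all
    ties at height A + 1. *)
Lemma run_cons_rcons k c W A : 0 < k -> k + c <= A.+1 ->
  exists W' A', run k c (rcons W A) = rcons W' A' /\
    run k c (A.+1 :: W) = A'.+1 :: W'.
Proof.
elim: c k W A => [|c IH] k W A k0 kc; first by exists W, A.
rewrite [run _ _ (rcons _ _)]/= [run _ _ (A.+1 :: W)]/=.
case: (boolP (has (fun x => (k <= x) && (x <= A)) W)) => h.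
  rewrite place_rcons ?h ?orbT // ifF; first by apply: IH => //; lia.
  apply/negbTE/nandP; right; apply/allPn; case/hasP: h => x xW hx.
  by exists x => //; lia.
rewrite place_rcons_last; try lia; last first.
  by apply: no_alive h _ => x; lia.
rewrite ifT; first by apply: IH => //; lia.
apply/andP; split; first by lia.
by apply: no_alive h _ => x; lia.
Qed.

Lemma run_tight_head k q W : run k q (k :: W) = k + q :: W.
Proof.
elim: q k => [|q IH] k /=; first by rewrite addn0.
rewrite /receives leqnn /= ifT ?IH ?addSnnS //.
by apply/allP => x _; lia.
Qed.

(** Dispersing q beads over a runner with p beads above level k gives the same
    as exchanging the roles of p and q. As soon as the front runner has
    exactly the height of the current level it takes all remaining beads, and
    until then the beads are shared freely. *)
Lemma run_swap_carry q k p W : 0 < k -> p <= q -> ready k W ->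
  run k q (k + p :: W) = run k p (k + q :: W).
Proof.
elim: q k p W => [|q IH] k p W k0 pq iW.
  by have -> : p = 0 by lia.
have [->|pq'] := eqVneq p q.+1; first by [].
case: p pq pq' => [_ _|p pq pq']; first by rewrite addn0 run_tight_head.
case: (boolP (has (fun x => (k <= x) && (x <= k + p)) W)) => h.
  have hP y : k + p < y -> receives k y W = false.
    move=> hy; apply/negbTE/nandP; right; apply/allPn; case/hasP: h => x xW hx.
    by exists x => //; lia.
  rewrite /= !hP; try lia.
  by rewrite -!addSnnS IH //; apply: ready_place.
(* Every nonempty runner is now at least as high as the front one, so no
   bead finds a runner too low. *)
have bW := ready_tall k0 iW h.
have hP : receives k (k + p.+1) W.
  apply/andP; split; first by lia.
  by apply: no_alive h _ => x; lia.
rewrite [run k q.+1 _]/= hP.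
have -> : (k + p.+1).+1 = k.+1 + p.+1 by lia.
rewrite IH //; try lia; last by apply: tall_ready; apply: tall_sub bW; lia.
rewrite addSnnS; apply: run_tall => //=; apply/andP; split; try lia.
  by apply: tall_sub bW; lia.
by apply: tall_sub bW; lia.
Qed.

(** Adjacent runners have no other runner between them to break ties, so
    distinct heights x and y play symmetric roles. *)
Lemma place_swap k A x y B : x < y ->
  exists A' x' y' B', [/\ size A' = size A, x' <= y',
    place k (A ++ x :: y :: B) = A' ++ x' :: y' :: B' &
    place k (A ++ y :: x :: B) = A' ++ y' :: x' :: B'].
Proof.
move=> xy; elim: A => [|a A [A' [x' [y' [B' [sA xy' e1 e2]]]]]].
  rewrite /= /receives /= (leqNgt y) xy (ltnW xy) orbT orbF andTb.
  have allS z : all (fun t => (t < k) || (y <= t)) B ->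
      z <= y -> all (fun t => (t < k) || (z <= t)) B.
    by move=> a zy; apply: sub_all a => t; lia.
  case: (leqP k x) => [kx|xk] /=.
    rewrite andbF; case: ifP => aB.
      by exists [::], x.+1, y, B; split.
    rewrite ifF; last first.
      by apply/negbTE/negP => /andP[_ /allS /(_ (ltnW xy))]; rewrite aB.
    by exists [::], x, y, (place k B); split=> //; apply: ltnW.
  case: ifP => _; first by exists [::], x, y.+1, B; split=> //; lia.
  by exists [::], x, y, (place k B); split=> //; apply: ltnW.
rewrite !cat_cons [place _ _]/= [place k (a :: A ++ y :: _)]/= e1 e2.
have -> : receives k a (A ++ y :: x :: B) = receives k a (A ++ x :: y :: B).
  rewrite /receives; congr (_ && _); apply: perm_all.
  rewrite perm_cat2l -![_ :: _ :: B]/([:: _; _] ++ B) perm_cat2r.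
  by rewrite (perm_catC [:: y] [:: x]).
case: ifP => _; first by exists (a.+1 :: A), x, y, B; split=> //; apply: ltnW.
by exists (a :: A'), x', y', B'; rewrite /= sA.
Qed.

(** Once the two entries become equal, the two lists agree for good; hence the
    first alternative. *)
Definition swapped (e : nat) (h h' : seq nat) : Prop :=
  h = h' \/ exists A x y B,
    [/\ size A = e, h = A ++ x :: y :: B & h' = A ++ y :: x :: B].

Lemma swapped_place e k h h' : swapped e h h' ->
  swapped e (place k h) (place k h').
Proof.
case=> [->|[A [x [y [B [<- -> ->]]]]]]; first by left.
case: (ltngtP x y) => [xy|xy|->]; last by left.
  have [A' [x' [y' [B' [sA _ -> ->]]]]] := place_swap k A B xy.
  by right; exists A', x', y', B'.
have [A' [x' [y' [B' [sA _ -> ->]]]]] := place_swap k A B xy.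
by right; exists A', y', x', B'.
Qed.

Lemma swapped_run e k c h h' : swapped e h h' ->
  swapped e (run k c h) (run k c h').
Proof.
elim: c k h h' => //= c IH k h h' s; apply/IH/swapped_place/s.
Qed.

Definition descent (e : nat) (h : seq nat) : Prop :=
  nth 0 h e.+1 <= nth 0 h e.

Lemma descent_place e k h : descent e h -> descent e (place k h).
Proof.
rewrite /descent; elim: h e => //= a h IH [|e] /=.
  2: by case: ifP => //= _; apply: IH.
case: ifP => [_|] /=; first by lia.
case: h {IH} => // b h /= pr ba; case: ifP => //= pb.
rewrite ltn_neqAle ba andbT; apply/eqP => e; move: pr pb.
by rewrite /receives e /= leqnn orbT /= => ->.
Qed.

Lemma descent_run e k c h : descent e h -> descent e (run k c h).
Proof. by elim: c k h => //= c IH k h s; apply/IH/descent_place. Qed.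

(** One position of the scan: the last runner passes the current position,
    where J has a bead or a gap, and becomes the first one. *)
Definition step (bead : bool) (h : seq nat) : seq nat :=
  let W := take (size h).-1 h in let b := last 0 h in
  if bead then b.+1 :: W else 0 :: run 1 b W.

Lemma step_rcons bead W b :
  step bead (rcons W b) = if bead then b.+1 :: W else 0 :: run 1 b W.
Proof. by rewrite /step size_rcons last_rcons -cats1 take_size_cat. Qed.

Lemma size_step bead h : h != [::] -> size (step bead h) = size h.
Proof.
case/lastP: h => // W b _; rewrite step_rcons size_rcons.
by case: bead; rewrite //= size_run.
Qed.

Lemma step_eq0 bead h e : h != [::] ->
  (nth 0 (step bead h) e == 0) =
  if e is e'.+1 then (size h <= e) || (nth 0 h e' == 0) else ~~ bead.
Proof.
case/lastP: h => // W b _; rewrite step_rcons size_rcons.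
case: e => [|e]; first by case: bead.
have -> : (nth 0 (if bead then b.+1 :: W else 0 :: run 1 b W) e.+1 == 0) =
    (nth 0 W e == 0) by case: bead => //=; rewrite run_eq0.
rewrite ltnS nth_rcons; case: ltnP => //= h.
by rewrite nth_default.
Qed.

Lemma step_swapped e bead h h' : e.+2 < size h -> swapped e h h' ->
  swapped e.+1 (step bead h) (step bead h').
Proof.
move=> se [->|[A [x [y [B [sA eh eh']]]]]]; first by left.
have : 0 < size B by move: se; rewrite eh size_cat /= sA; lia.
case/lastP: B eh eh' => // B b -> -> _.
rewrite -!rcons_cons -!rcons_cat !step_rcons.
case: bead.
  by right; exists (b.+1 :: A), x, y, B; rewrite /= sA.
have : swapped e (A ++ x :: y :: B) (A ++ y :: x :: B).
  by right; exists A, x, y, B.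
move/(swapped_run 1 b) => [->|[A' [x' [y' [B' [sA' -> ->]]]]]]; first by left.
by right; exists (0 :: A'), x', y', B'; rewrite /= sA'.
Qed.

Lemma step_descent e bead h : e.+2 < size h -> descent e h ->
  descent e.+1 (step bead h).
Proof.
case/lastP: h => // W b; rewrite size_rcons step_rcons => sW.
have dW : descent e (rcons W b) -> descent e W.
  by rewrite /descent !nth_rcons !ifT //; lia.
move=> /dW d; case: bead; first exact: d.
exact: descent_run.
Qed.

Lemma step_neither W a b :
  step false (step false (rcons (rcons W a) b)) =
  0 :: 0 :: run 1 a (run 1 b W).
Proof.
rewrite step_rcons.
have [W' [A' [-> <-]]] := @run_rcons 1 b W a isT (ready1 W).
by rewrite -rcons_cons step_rcons run0.
Qed.

Lemma step_both W a b :
  step true (step true (rcons (rcons W a) b)) = a.+1 :: b.+1 :: W.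
Proof. by rewrite step_rcons -rcons_cons step_rcons. Qed.

(** Two gaps: both columns are dispersed, one after the other, and by
    [run1_comm] their order is irrelevant. *)
Lemma step_neitherC W a b :
  step false (step false (rcons (rcons W a) b)) =
  step false (step false (rcons (rcons W b) a)).
Proof. by rewrite !step_neither run1_comm. Qed.

Lemma run1_carryC a b W : run 1 a (b.+1 :: W) = run 1 b (a.+1 :: W).
Proof.
wlog ab : a b / b <= a => [H|].
  by case: (leqP b a) => ab; [|symmetry]; apply: H => //; apply: ltnW.
by rewrite -[b.+1]add1n -[a.+1]add1n run_swap_carry //; apply: ready1.
Qed.

Lemma step_right W a b :
  step false (step true (rcons (rcons W a) b)) = 0 :: run 1 a (b.+1 :: W).
Proof. by rewrite step_rcons -rcons_cons step_rcons. Qed.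

(** A bead at i + 1 and a gap at i. *)
Lemma step_rightC W a b :
  step false (step true (rcons (rcons W a) b)) =
  step false (step true (rcons (rcons W b) a)).
Proof. by rewrite !step_right run1_carryC. Qed.

(** This is where a lowering operator acts: a bead at i with a gap at i + 1,
    against a gap at i with a bead at i + 1. *)
Lemma step_left_right W a b : b <= a ->
  exists c W', step true (step false (rcons (rcons W a) b)) = c :: 0 :: W' /\
    step false (step true (rcons (rcons W a) b)) = 0 :: c :: W'.
Proof.
move=> ba; rewrite step_right run1_carryC step_rcons.
have [||W' [A' [-> ->]]] := @run_cons_rcons 1 b W a; rewrite ?add1n //.
by exists A'.+1, W'; rewrite -rcons_cons step_rcons.
Qed.

Lemma step_left W a b :
  exists c W', step true (step false (rcons (rcons W a) b)) = c :: 0 :: W'.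
Proof.
rewrite step_rcons; have [W' [A' [-> _]]] := @run_rcons 1 b W a isT (ready1 W).
by exists A'.+1, W'; rewrite -rcons_cons step_rcons.
Qed.

(** * Counting elements from above: order, charge and Bruhat order *)

Local Open Scope classical_set_scope.
Local Open Scope ring_scope.

Lemma zmaxE (A : set int) x : A x -> (forall y, A y -> y <= x) -> zmax A = x.
Proof.
move=> Ax Ux; rewrite /zmax; case: xgetP => [y -> [Ay Uy]|/(_ x)].
  by apply/le_anti; rewrite Ux ?Uy.
by case.
Qed.

Lemma zminE (A : set int) x : A x -> (forall y, A y -> x <= y) -> zmin A = x.
Proof.
move=> Ax Ux; rewrite /zmin; case: xgetP => [y -> [Ay Uy]|/(_ x)].
  by apply/le_anti; rewrite Ux ?Uy.
by case.
Qed.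

(** The number of elements of J in ]b - t, b]; for b above J, this is the
    number of elements above b - t. *)
Definition count_top (b : int) (J : set int) (t : nat) : nat :=
  (\sum_(s < t) `[< J (b - s%:Z)%R >])%N.

Lemma count_top0 b J : count_top b J 0 = 0%N.
Proof. by rewrite /count_top big_ord0. Qed.

Lemma count_topS b J t :
  count_top b J t.+1 = (count_top b J t + `[< J (b - t%:Z)%R >])%N.
Proof. by rewrite /count_top big_ord_recr. Qed.

Lemma count_topD b J t l :
  count_top b J (t + l) = (count_top b J t + count_top (b - t%:Z)%R J l)%N.
Proof.
elim: l => [|l IH]; first by rewrite count_top0 !addn0.
by rewrite addnS !count_topS IH addnA PoszD opprD addrA.
Qed.

Lemma count_top_le b J t t' : (t <= t')%N ->
  (count_top b J t <= count_top b J t')%N.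
Proof. by move=> /subnKC <-; rewrite count_topD leq_addr. Qed.

Lemma count_top_full b (J : set int) l : (forall s : nat, J (b - s%:Z)) ->
  count_top b J l = l.
Proof.
by move=> f; elim: l => [|l IH]; rewrite ?count_top0 // count_topS IH asboolT ?addn1.
Qed.

Lemma count_top_empty b (J : set int) l :
  (forall s : nat, (s < l)%N -> ~ J (b - s%:Z)) ->
  count_top b J l = 0%N.
Proof.
elim: l => [|l IH] f; first by rewrite count_top0.
by rewrite count_topS IH ?asboolF //; [apply: f | move=> s sl; apply: f; lia].
Qed.

(** J is free only between b - T and b; having m - b + T elements there means
    having order m. *)
Definition maya (b : int) (T : nat) (J : set int) (m : int) : Prop :=
  [/\ forall y, b < y -> ~ J y, forall t : nat, (T <= t)%N -> J (b - t%:Z)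
    & (count_top b J T)%:Z = m - b + T%:Z].

(** Membership in T with order m, by [chargedP]. *)
Definition charged (J : set int) (m : int) : Prop := exists b T, maya b T J m.

Lemma maya_below b T T' J m : (T <= T')%N -> maya b T J m -> maya b T' J m.
Proof.
move=> TT [up lo c]; split=> //; first by move=> t h; apply: lo; lia.
rewrite -(subnKC TT) count_topD (@count_top_full (b - T%:Z)); first by lia.
by move=> s; rewrite -addrA -opprD -PoszD; apply: lo; lia.
Qed.

Lemma maya_above b k T J m : maya b T J m -> maya (b + k%:Z) (k + T) J m.
Proof.
move=> [up lo c]; split; first by move=> y h; apply: up; lia.
  move=> t h; have -> : b + k%:Z - t%:Z = b - (t - k)%N%:Z by lia.
  by apply: lo; lia.
rewrite count_topD count_top_empty; last by move=> s sk; apply: up; lia.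
by rewrite addrK; lia.
Qed.

Lemma charged_maya J m : charged J m ->
  exists b0 : int, forall b : int, b0 <= b ->
  exists T0 : nat, forall T : nat, (T0 <= T)%N -> maya b T J m.
Proof.
case=> b0 [T0 h]; exists b0 => b hb; exists (`|b - b0| + T0)%N => T hT.
apply: maya_below hT _.
have -> : b = b0 + `|b - b0|%N%:Z by lia.
by rewrite (_ : `|_ - _|%N = `|b - b0|%N); [apply: maya_above | lia].
Qed.

Lemma next_elt b (J : set int) t : (exists2 s, (t <= s)%N & J (b - s%:Z)) ->
  exists s : nat, [/\ (t <= s)%N, J (b - s%:Z),
    forall s' : nat, (t <= s')%N -> (s' < s)%N -> ~ J (b - s'%:Z)
    & count_top b J s = count_top b J t].
Proof.
move=> [s0 ts0 Js0].
have ex : exists s, (t <= s)%N && `[< J (b - s%:Z) >].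
  by exists s0; rewrite ts0; apply/asboolP.
case: (ex_minnP ex) => s /andP[ts /asboolP Js] mn; exists s.
have emp s' : (t <= s')%N -> (s' < s)%N -> ~ J (b - s'%:Z).
  by move=> ts' s's J'; have := mn s'; rewrite ts' asboolT // => /(_ isT); lia.
split=> //; rewrite -(subnKC ts) count_topD (@count_top_empty (b - t%:Z)).
  by rewrite addn0.
move=> l ll.
by rewrite -addrA -opprD -PoszD; apply: emp; lia.
Qed.

Lemma eltE b T J m k : maya b T J m ->
  exists t : nat, [/\ elt J k = b - t%:Z, J (b - t%:Z) & count_top b J t = k].
Proof.
move=> [up lo c]; elim: k => [|k [t [et Jt ct]]] /=.
  have [|s [_ Js mn cs]] := @next_elt b J 0; first by exists T => //; apply: lo.
  exists s; rewrite cs count_top0; split=> //; apply: zmaxE => // y Jy.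
  have yb : y <= b by rewrite leNgt; apply/negP => /up.
  have ey : y = b - `|b - y|%N%:Z by lia.
  have := mn `|b - y|%N isT; rewrite -ey.
  by case: (ltnP `|b - y|%N s) => [_ /(_ isT)//|]; lia.
have [|s [ts Js mn cs]] := @next_elt b J t.+1.
  by exists (maxn t.+1 T); rewrite ?leq_maxl //; apply: lo; rewrite leq_maxr.
exists s; rewrite cs count_topS ct asboolT // addn1; split=> //; apply: zmaxE.
  by split=> //=; rewrite et; lia.
move=> y [Jy /=]; rewrite et => yt.
have ey : y = b - `|b - y|%N%:Z by lia.
have := mn `|b - y|%N; rewrite -ey.
by case: (ltnP `|b - y|%N s) => [? h|]; [case: h => //; lia | lia].
Qed.

(** The counting function and the enumeration of J determine each other; this
    turns the Bruhat order, defined elementwise, into an order on counts. *)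
Lemma lt_elt b T J m k t : maya b T J m ->
  (b - t%:Z < elt J k) = (k < count_top b J t)%N.
Proof.
move=> h; have [s [-> Js <-]] := eltE k h.
have -> : (b - t%:Z < b - s%:Z) = (s < t)%N by lia.
case: (ltnP s t) => st.
  by apply/esym/(leq_trans _ (count_top_le b J st)); rewrite count_topS asboolT // addn1.
by rewrite ltnNge count_top_le.
Qed.

Lemma elt_surj b T J m z : maya b T J m -> J z -> exists k, elt J k = z.
Proof.
move=> h Jz; have [up _ _] := h.
have zb : z <= b by rewrite leNgt; apply/negP => /up.
have ez : z = b - `|b - z|%N%:Z by lia.
set t := `|b - z|%N in ez; exists (count_top b J t).
have [s [es Js cs]] := eltE (count_top b J t) h.
rewrite es ez; case: (ltngtP s t) => [st|ts|->//].
  have := count_top_le b J st; rewrite count_topS asboolT // addn1 cs; lia.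
have := count_top_le b J ts; rewrite count_topS asboolT -?ez // addn1 cs; lia.
Qed.

Lemma elt_maya b T J m k : maya b T J m -> J (elt J k).
Proof. by move=> /(eltE k)[s [-> Js _]]. Qed.

Lemma elt_mayaS b T J m k : maya b T J m ->
  elt J k.+1 < elt J k /\ forall y, J y -> y < elt J k -> y <= elt J k.+1.
Proof.
move=> h; have [up _ _] := h; have [t [et Jt ct]] := eltE k h.
have [s [es Js cs]] := eltE k.+1 h.
have ts : (t < s)%N.
  by rewrite ltnNge; apply/negP => /(count_top_le b J); lia.
split; first by rewrite et es; lia.
move=> y Jy; rewrite et es => yt; rewrite leNgt; apply/negP => sy.
have ey : y = b - `|b - y|%N%:Z by lia.
set u := `|b - y|%N in ey.
have tu : (t < u)%N by lia.
have us : (u < s)%N by lia.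
have h1 := count_top_le b J tu; have h2 := count_top_le b J us.
rewrite !count_topS !asboolT -?ey // in h1 h2; lia.
Qed.

(** For sets bounded above and full far below, this is n-boundedness. *)
Definition linked (n : nat) (J : set int) : Prop :=
  forall z, J z -> exists y, [/\ J y, y < z & z - n%:Z <= y].

Lemma nboundedP n J m : charged J m -> nbounded n J <-> linked n J.
Proof.
move=> [b [T h]]; split=> [nb z Jz|w k].
  have [k ek] := elt_surj h Jz; exists (elt J k.+1).
  have [lt _] := elt_mayaS k h; have := nb k; rewrite -ek => ?.
  by split=> //; [apply: elt_maya h | lia].
have [y [Jy yz zy]] := w _ (elt_maya k h).
by have [_ /(_ y Jy yz)] := elt_mayaS k h; lia.
Qed.

Lemma elt_eventually b T J m : maya b T J m ->
  forall k : nat, (count_top b J T <= k)%N -> elt J k = m - k%:Z.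
Proof.
move=> h k hk; have [up lo c] := h; have [t [-> Jt ct]] := eltE k h.
have Tt : (T <= t)%N.
  rewrite leqNgt; apply/negP => /(count_top_le b J).
  by rewrite count_topS asboolT //; lia.
by have [_ _] := maya_below Tt h; lia.
Qed.

(** The equality of far elements required in the Bruhat order holds
    automatically for sets of the same order. *)
Lemma bruhat_count_top b T K J m : maya b T K m -> maya b T J m ->
  bruhat_le K J <-> forall t, (count_top b K t <= count_top b J t)%N.
Proof.
move=> hK hJ; split=> [[le _] t|le].
  rewrite leqNgt; apply/negP => lt.
  have := le (count_top b J t); move: lt; rewrite -(lt_elt _ _ hK) => h1 h2.
  by have := lt_le_trans h1 h2; rewrite (lt_elt _ _ hJ) ltnn.
split=> [k|].
  have [s [es Js cs]] := eltE k hK.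
  have := le s.+1; rewrite es count_topS cs asboolT // addn1.
  by rewrite -(lt_elt _ _ hJ); lia.
exists (maxn (count_top b K T) (count_top b J T)) => k; rewrite geq_max => /andP[h1 h2].
by rewrite (elt_eventually hK) // (elt_eventually hJ).
Qed.

Lemma charged2 K J m : charged K m -> charged J m ->
  exists b0 : int, forall b, b0 <= b -> exists T0 : nat, forall T, (T0 <= T)%N ->
    maya b T K m /\ maya b T J m.
Proof.
move=> /charged_maya[b1 h1] /charged_maya[b2 h2].
exists (Num.max b1 b2) => b; rewrite ge_max => /andP[/h1[T1 g1] /h2[T2 g2]].
by exists (maxn T1 T2) => T; rewrite geq_max => /andP[/g1 ? /g2 ?].
Qed.

(** The bound b is only there to have a common upper bound for sets under
    comparison. *)
Definition count_le (K J : set int) : Prop :=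
  exists b0 : int, forall b : int, b0 <= b ->
    forall t, (count_top b K t <= count_top b J t)%N.

Lemma bruhat_count_le K J m : charged K m -> charged J m ->
  bruhat_le K J <-> count_le K J.
Proof.
move=> cK cJ; have [b0 h] := charged2 cK cJ; split.
  move=> le; exists b0 => b /h[T0 /(_ T0 (leqnn _)) [hK hJ]].
  exact/(bruhat_count_top hK hJ).
move=> [b1 d]; have [|T0 /(_ T0 (leqnn _)) [hK hJ]] := h (Num.max b0 b1).
  by rewrite le_max lexx.
by apply/(bruhat_count_top hK hJ)/d; rewrite le_max lexx orbT.
Qed.

Lemma count_le_refl J : count_le J J.
Proof. by exists 0. Qed.

Lemma count_le_trans J K M : count_le J K -> count_le K M -> count_le J M.
Proof.
move=> [b1 h1] [b2 h2]; exists (Num.max b1 b2) => b.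
rewrite ge_max => /andP[/h1 g1 /h2 g2] t; exact: leq_trans (g1 t) (g2 t).
Qed.

Lemma zcardU1 (A : set int) x : finite_set A -> ~ A x ->
  zcard (x |` A) = (zcard A).+1.
Proof.
move=> fA nAx; rewrite /zcard fset_setU1 // cardfsU1.
by rewrite in_fset_set // memNset.
Qed.

Lemma zcard0 : zcard set0 = 0%N.
Proof. by rewrite /zcard fset_set0 cardfs0. Qed.

Definition progression (P : set int) (r d : int) (l : nat) : set int :=
  [set j | P j /\ exists2 t : nat, (t < l)%N & j = r + d * t%:Z].

Lemma zcard_progression (P : set int) (r d : int) l : d != 0 ->
  finite_set (progression P r d l) /\
  zcard (progression P r d l) = (\sum_(t < l) `[< P (r + d * t%:Z)%R >])%N.
Proof.
move=> d0; elim: l => [|l [fl IH]].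
  have -> : progression P r d 0 = set0.
    by apply/seteqP; split=> // j [_ [t]].
  by rewrite zcard0 big_ord0; split.
rewrite big_ord_recr /=.
have [Pl|nPl] := pselect (P (r + d * l%:Z)).
  have -> : progression P r d l.+1 = (r + d * l%:Z) |` progression P r d l.
    apply/seteqP; split=> j.
      move=> [Pj [t tl ej]]; have [e|ne] := eqVneq t l.
        by left; rewrite ej e.
      by right; split=> //; exists t => //; lia.
    move=> [->|[Pj [t tl ej]]]; first by split=> //; exists l.
    by split=> //; exists t => //; lia.
  split; first by rewrite finite_setU.
  rewrite zcardU1 // ?IH ?asboolT ?addn1 // => -[_ [t tl]].
  by move/addrI/(mulfI d0) => [?]; lia.
have -> : progression P r d l.+1 = progression P r d l.
  apply/seteqP; split=> j [Pj [t tl ej]]; split=> //; exists t => //; last by lia.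
  by rewrite ltn_neqAle -ltnS tl andbT; apply/eqP => e; apply: nPl; rewrite -e -ej.
by rewrite IH asboolF ?addn0.
Qed.

Lemma finite_bound (A : set int) : finite_set A ->
  exists b : nat, forall y, A y -> (`|y| <= b)%N.
Proof.
move=> /finite_seqP[s ->]; exists (\max_(y <- s) `|y|)%N => y /= ys.
exact: (@leq_bigmax_seq _ _ xpredT (fun y : int => `|y|%N)).
Qed.

(** Splitting ]b - (b + T), b] at 0. *)
Lemma ord_count_top (b T : nat) (J : set int) : (forall y, b%:Z < y -> ~ J y) ->
  (forall t : nat, (b + T <= t)%N -> J (b%:Z - t%:Z)) ->
  [/\ finite_set (J `\` L 0), finite_set (L 0 `\` J) &
   ord J = (count_top b J (b + T))%:Z - T%:Z].
Proof.
move=> up lo.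
have eA : J `\` L 0 = progression J b%:Z (-1) b.
  apply/seteqP; split=> j.
    move=> [Jj /= /negP]; rewrite -ltNge => j0; split=> //.
    have jb : j <= b by rewrite leNgt; apply/negP => /up.
    by exists `|b%:Z - j|%N; lia.
  move=> [Jj [t tb ej]]; split=> // h; move: (h : j <= 0); lia.
have eB : L 0 `\` J = progression (~` J) 0 (-1) T.
  apply/seteqP; split=> j.
    move=> [j0 nJ]; have {}j0 : j <= 0 := j0.
    split=> //; exists `|j|%N; last by lia.
    rewrite ltnNge; apply/negP => Tj; apply: nJ.
    have -> : j = b%:Z - (b + `|j|)%N%:Z by lia.
    by apply: lo; lia.
  by move=> [Jj [t tb ej]]; split; [rewrite /L /=; lia | exact: Jj].
have [|f1 e1] := @zcard_progression J b (-1) b; first by [].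
have [|f2 e2] := @zcard_progression (~` J) 0 (-1) T; first by [].
rewrite /ord eA eB; split=> //.
rewrite e1 e2 count_topD subrr.
have -> : (\sum_(t < b) `[< J (b%:Z + -1 * t%:Z)%R >])%N = count_top b J b.
  by apply: eq_bigr => t _; rewrite mulN1r.
have : (\sum_(t < T) `[< (~` J) (0 + -1 * t%:Z)%R >] + count_top 0 J T = T)%N.
  rewrite /count_top -big_split /= -[RHS]card_ord -sum1_card; apply: eq_bigr => t _.
  have -> : `[< (~` J) (0 + -1 * t%:Z)%R >] = ~~ `[< J (- t%:Z)%R >].
    by rewrite mulN1r add0r; exact: asbool_neg.
  rewrite add0r.
  by case: asbool.
by move: (\sum_(t < T) _)%N (count_top b J b) (count_top 0 J T) => x y z; lia.
Qed.

Lemma chargedP J m : charged J m <-> calT J /\ ord J = m.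
Proof.
split=> [/charged_maya[b0 hb]|[[f1 f2] oJ]].
  have [|T0 /(_ (`|b0| + T0)%N) h] := hb `|b0|%N; first by lia.
  have [|up lo c] := h; first by lia.
  by have [f1 f2 ->] := ord_count_top up lo; split; [split | lia].
have [b1 h1] := finite_bound f1; have [b2 h2] := finite_bound f2.
have up (y : int) : b1%:Z < y -> ~ J y.
  move=> b1y Jy; have : (`|y| <= b1)%N; last by lia.
  by apply: h1; split=> // h; have {}h : y <= 0 := h; lia.
have lo (t : nat) : (b1 + b2.+1 <= t)%N -> J (b1%:Z - t%:Z).
  move=> ht; apply: contrapT => nJ.
  have : (`|b1%:Z - t%:Z| <= b2)%N; last by lia.
  by apply: h2; split=> //; rewrite /L /=; lia.
have [_ _ o] := ord_count_top up lo.
by exists b1%:Z, (b1 + b2.+1)%N; split=> //; rewrite -oJ o; lia.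
Qed.

Lemma crystalP n m J : crystal n m J <-> charged J m /\ linked n J.
Proof.
split=> [[cT oJ nb]|[cJ w]].
  by have cJ : charged J m; [exact/chargedP | split=> //; apply/(nboundedP n cJ)].
by have [? ?] := (chargedP J m).1 cJ; split=> //; apply/(nboundedP n cJ).
Qed.

Lemma swapE (J : set int) p q y : swap J p q y <-> (J y /\ y <> p) \/ y = q.
Proof. by []. Qed.

(** Written with additions only, to stay within the natural numbers. *)
Lemma count_top_swap b (J : set int) p q t : J p -> ~ J q -> p <= b -> q <= b ->
  (count_top b (swap J p q) t + (b - t%:Z < p)%R =
   count_top b J t + (b - t%:Z < q)%R)%N.
Proof.
move=> Jp Jq pb qb; elim: t => [|t IH].
  by rewrite !count_top0 subr0 !ltNge pb qb.
rewrite !count_topS.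
have pq : p <> q by move=> e; apply: Jq; rewrite -e.
have -> : `[< swap J p q (b - t%:Z) >] =
   (`[< J (b - t%:Z) >] && (b - t%:Z != p)) || (b - t%:Z == q).
  apply/asboolP/orP; rewrite swapE.
    case=> [[h /eqP h']|/eqP]; [left|by right].
    by rewrite asboolT.
  by case=> [/andP[/asboolP ? /eqP ?]|/eqP]; [left|right].
have hp : b - t%:Z = p -> `[< J (b - t%:Z) >] by move=> ->; apply/asboolP.
have hq : b - t%:Z = q -> `[< J (b - t%:Z) >] = false by move=> ->; apply/asboolF.
move: hp hq; case: asbool => hp hq.
  have nq : b - t%:Z != q by apply/eqP => /hq.
  by case: (eqVneq (b - t%:Z) p) => e /=; lia.
have np : b - t%:Z != p by apply/eqP => /hp.
by case: (eqVneq (b - t%:Z) q) => e /=; lia.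
Qed.

Lemma charged_swap J m p q : charged J m -> J p -> ~ J q ->
  charged (swap J p q) m.
Proof.
move=> /charged_maya[b0 hb] Jp Jq.
have [|T0 hT] := hb (Num.max b0 (Num.max p q)); first by rewrite le_max lexx.
set b := Num.max _ _ in hT.
have pb : p <= b by rewrite !le_max lexx ?orbT.
have qb : q <= b by rewrite !le_max lexx ?orbT.
(* The cut b - T has to lie below p and q. *)
pose T := (T0 + `|b - p| + `|b - q|).+1%N.
have [|up lo c] := hT T; first by rewrite /T; lia.
exists b, T; split.
- by move=> y by_ /swapE[[/(up _ by_)]|e] //; lia.
- move=> t tT; apply/swapE; left; split; first by apply: lo; lia.
  by move: tT; rewrite /T; lia.
have := count_top_swap T Jp Jq pb qb.
have -> : (b - T%:Z < p) = true by rewrite /T; lia.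
have -> : (b - T%:Z < q) = true by rewrite /T; lia.
by move: c; lia.
Qed.

Lemma count_le_swap J p q : J p -> ~ J q -> p < q -> count_le J (swap J p q).
Proof.
move=> Jp Jq pq; exists q => b qb t.
have := count_top_swap t Jp Jq _ qb; lia.
Qed.

(** * Simple reflections and the exchange condition *)

Definition in_class (n : nat) (i : 'I_n) (x : int) : bool :=
  (x == i%:Z %[mod n%:Z])%Z.

Section Reflection.
Variable n : nat.
Hypothesis n1 : (1 < n)%N.
Implicit Types i j : 'I_n.

Lemma class_dvd i x : in_class i x = (n%:Z %| x - i%:Z)%Z.
Proof. by rewrite /in_class eqz_mod_dvd. Qed.

Lemma class_near i x d : in_class i x -> in_class i (x + d) = (n%:Z %| d)%Z.
Proof.
rewrite !class_dvd => h; have -> : x + d - i%:Z = (x - i%:Z) + d by lia.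
by rewrite rpredDl.
Qed.

Lemma sE i x : s i x =
  if in_class i x then x + 1 else if in_class i (x - 1) then x - 1 else x.
Proof.
rewrite /s -/(in_class i x) [in_class i (x - 1)]class_dvd eqz_mod_dvd.
by have -> : x - (i%:Z + 1) = x - 1 - i%:Z by lia.
Qed.

Lemma image_s i (J : set int) y : (s i @` J) y <-> J (s i y).
Proof.
split=> [[x Jx <-]|Jy]; first by rewrite sK.
by exists (s i y) => //; rewrite sK.
Qed.

Lemma dvd1n : (n%:Z %| 1)%Z = false.
Proof. by apply/negbTE; rewrite dvdz1 /=; lia. Qed.

Lemma dvdN1n : (n%:Z %| - 1)%Z = false.
Proof. by apply/negbTE; rewrite dvdzE /= dvdn1; lia. Qed.

Lemma class_succ i x : in_class i x -> in_class i (x + 1) = false.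
Proof. by move=> h; rewrite class_near ?dvd1n. Qed.

Lemma class_pred i x : in_class i x -> in_class i (x - 1) = false.
Proof. by move=> h; rewrite class_near ?dvdN1n. Qed.

Lemma s_cls i x : in_class i x -> s i x = x + 1.
Proof. by rewrite sE => ->. Qed.

Lemma s_cls1 i x : in_class i (x - 1) -> s i x = x - 1.
Proof.
move=> h; rewrite sE h; have := class_succ h; rewrite subrK => -> //.
Qed.

Lemma s_ncls i x : in_class i x = false -> in_class i (x - 1) = false -> s i x = x.
Proof. by rewrite sE => -> ->. Qed.

Lemma s_near i x : x - 1 <= s i x <= x + 1.
Proof. by rewrite sE; case: ifP => _; [lia|case: ifP => _; lia]. Qed.

Lemma image_s_cls i J x : in_class i x -> (s i @` J) x <-> J (x + 1).
Proof. by move=> h; rewrite (image_s _) s_cls. Qed.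

Lemma image_s_cls1 i J x : in_class i x -> (s i @` J) (x + 1) <-> J x.
Proof. by move=> h; rewrite (image_s _) s_cls1 addrK. Qed.

(** Only at a cut between x = i and x + 1 does s_i change the number of
    elements above. *)
Lemma count_top_image i b (J : set int) t : (forall y, b < y -> ~ J y) ->
  (forall y, b < y -> ~ (s i @` J) y) ->
  if in_class i (b - t%:Z) then
    (count_top b (s i @` J) t + `[< J (b - t%:Z + 1)%R >] =
     count_top b J t + `[< J (b - t%:Z)%R >])%N
  else count_top b (s i @` J) t = count_top b J t.
Proof.
move=> uJ usJ; elim: t => [|t IH].
  rewrite !count_top0 subr0; case: ifP => // cb.
  rewrite !asboolF //; last by apply: uJ; lia.
  by move/(image_s_cls1 _ cb); apply: usJ; lia.
rewrite !count_topS; set x := b - t%:Z in IH *.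
have ex : b - t.+1%:Z = x - 1 by rewrite /x; lia.
rewrite ex; case: (boolP (in_class i x)) IH => cx IH.
  rewrite class_pred //.
  have -> : `[< (s i @` J) x >] = `[< J (x + 1) >].
    by apply: asbool_equiv_eq; apply: image_s_cls.
  by rewrite IH.
case: ifP => cx1.
  have -> : `[< (s i @` J) x >] = `[< J (x - 1) >].
    apply: asbool_equiv_eq; have := image_s_cls1 J cx1; by rewrite subrK.
  by rewrite subrK IH addnAC.
have -> : `[< (s i @` J) x >] = `[< J x >].
  apply: asbool_equiv_eq; rewrite (image_s _) s_ncls //; exact/negbTE.
by rewrite IH.
Qed.

Lemma image_above i b (J : set int) : (forall y, b < y -> ~ J y) ->
  forall y, b + 1 < y -> ~ (s i @` J) y.
Proof.
move=> u y by_ /(image_s _); apply: u; have := s_near i y; lia.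
Qed.

Lemma charged_above i J m : charged J m -> exists b0 : int, forall b, b0 <= b ->
  (forall y, b < y -> ~ J y) /\ (forall y, b < y -> ~ (s i @` J) y).
Proof.
move=> [b [T [up _ _]]]; exists (b + 1) => b' bb; split=> y hy.
  by apply: up; lia.
by apply: (@image_above i _ _ up); lia.
Qed.

Lemma charged_image i J m : charged J m -> charged (s i @` J) m.
Proof.
move=> cJ; have [b0 h0] := charged_above i cJ.
have [b1 h1] := charged_maya cJ.
pose b := Num.max b0 b1.
have [|u us] := h0 b; first by rewrite le_max lexx.
have [|T hT] := h1 b; first by rewrite le_max lexx orbT.
have [_ lo _] := hT T (leqnn _).
(* Two more elements, so that s_i maps the part below the cut b - T.+2 into
   the part filled by J. *)
have [_ _ c] := hT T.+2 (ltnW (leqnSn _)).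
exists b, T.+2; split=> // [t tT|].
  apply/(image_s _); have := s_near i (b - t%:Z) => ?.
  have -> : s i (b - t%:Z) = b - `|b - s i (b - t%:Z)|%N%:Z by lia.
  by apply: lo; lia.
rewrite -c; congr Posz; have := count_top_image T.+2 u us.
case: ifP => // _.
have J1 : J (b - T.+2%:Z + 1).
  by have -> : b - T.+2%:Z + 1 = b - T.+1%:Z; [lia | apply: lo].
have J2 : J (b - T.+2%:Z) by apply: lo; lia.
by rewrite !asboolT // => /addIn.
Qed.

(** J <= s_i J, for n-stable J. *)
Definition iminimal i (S : set int) : Prop :=
  forall x, in_class i x -> S (x + 1) -> S x.
(** s_i J <= J, for n-stable J. *)
Definition imaximal i (S : set int) : Prop :=
  forall x, in_class i x -> S x -> S (x + 1).

Lemma imax_image i S : iminimal i S -> imaximal i (s i @` S).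
Proof.
move=> h x cx; rewrite (image_s_cls _ cx) (image_s_cls1 _ cx); exact: h.
Qed.

Lemma asbool_implyb (P Q : Prop) : (P -> Q) -> `[< P >] ==> `[< Q >].
Proof. by move=> h; apply/implyP => /asboolP /h /asboolP. Qed.

(** First lifting property. At a cut between x = i and x + 1 where K gains an
    element, either x is not in S and the cut just below x gives the bound, or
    x + 1 is in S and the cut just above x + 1 does. *)
Lemma count_le_imax i K S m : charged K m -> count_le K S -> imaximal i S ->
  count_le (s i @` K) S.
Proof.
move=> /(charged_above i)[b0 h0] [b1 h1] mS; exists (Num.max b0 b1) => b.
rewrite ge_max => /andP[/h0[u us] /h1 d] t.
have := count_top_image t u us; case: ifP => [cx|_ ->//].
case: t cx => [|t] cx; first by rewrite !count_top0.
have ex : b - t%:Z = b - t.+1%:Z + 1 by lia.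
have := d t; have := d t.+1; have := d t.+2; rewrite !count_topS ex.
have := asbool_implyb (@mS _ cx).
do 2![case: `[< K _ >]]; do 2![case: `[< S _ >]]; lia.
Qed.

(** Second lifting property. At a cut where S has one element fewer than s_i
    S, the neighbouring cut below or above gives the bound for K, according to
    whether K contains x + 1. *)
Lemma count_le_lift i K S m : charged S m -> count_le K (s i @` S) ->
  iminimal i K -> iminimal i S -> count_le K S.
Proof.
move=> /(charged_above i)[b0 h0] [b1 h1] mK mS; exists (Num.max b0 b1) => b.
rewrite ge_max => /andP[/h0[u us] /h1 d] t.
have := count_top_image t u us; case: ifP => [cx|_ <-//].
case: t cx => [|t] cx; first by rewrite !count_top0.
have ex : b - t%:Z = b - t.+1%:Z + 1 by lia.
have := d t; have := d t.+1; have := d t.+2; rewrite !count_topS ex.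
have -> : `[< (s i @` S) (b - t.+1%:Z) >] = `[< S (b - t.+1%:Z + 1) >].
  by apply: asbool_equiv_eq; apply: image_s_cls.
have -> : `[< (s i @` S) (b - t.+1%:Z + 1) >] = `[< S (b - t.+1%:Z) >].
  by apply: asbool_equiv_eq; apply: image_s_cls1.
have := asbool_implyb (@mS _ cx); have := asbool_implyb (@mK _ cx).
do 2![case: `[< K _ >]]; do 2![case: `[< S _ >]]; lia.
Qed.

Lemma count_le_image i S m : charged S m -> iminimal i S ->
  count_le S (s i @` S).
Proof.
move=> /(charged_above i)[b0 h0] mS; exists b0 => b /h0[u us] t.
have := count_top_image t u us; case: ifP => [cx|_ <-//].
have := asbool_implyb (@mS _ cx).
do 2![case: `[< S _ >]]; lia.
Qed.

Lemma s_periodic i x (k : int) : s i (x + k * n%:Z) = s i x + k * n%:Z.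
Proof.
have c y : in_class i (y + k * n%:Z) = in_class i y.
  rewrite !class_dvd; have -> : y + k * n%:Z - i%:Z = y - i%:Z + k * n%:Z by lia.
  by rewrite rpredDr // dvdz_mull.
rewrite !sE c; have -> : x + k * n%:Z - 1 = x - 1 + k * n%:Z by lia.
by rewrite c; case: ifP => _; [lia|case: ifP => _; lia].
Qed.

Lemma class_diff i x y : in_class i x -> in_class i y ->
  exists k : int, y = x + k * n%:Z.
Proof.
rewrite !class_dvd => hx hy; have := rpredB hy hx => /dvdzP[k e].
by exists k; rewrite -e; lia.
Qed.

(** Conjugating s_i by a periodic permutation g that maps some adjacent pair
    x0, x0 + 1 exchanged by s_i to an adjacent pair exchanged by s_j. *)
Lemma s_conj i j (g : int -> int) x0 : injective g ->
  (forall x (k : int), g (x + k * n%:Z) = g x + k * n%:Z) ->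
  in_class i x0 -> in_class j (g x0) -> g (x0 + 1) = g x0 + 1 ->
  forall x, s j (g x) = g (s i x).
Proof.
move=> gI gp c0 cj g1 x.
have clsj y : in_class j y -> exists k : int, y = g (x0 + k * n%:Z).
  rewrite !class_dvd in cj *; move=> hy; have := rpredB hy cj => /dvdzP[k e].
  by exists k; rewrite gp -e; lia.
case: (boolP (in_class i x)) => cx.
  rewrite (s_cls cx); have [k ->] := class_diff c0 cx.
  have -> : x0 + k * n%:Z + 1 = x0 + 1 + k * n%:Z by lia.
  rewrite !gp g1 sE ifT; first by lia.
  rewrite class_near // dvdz_mull //.
case: (boolP (in_class i (x - 1))) => cx1.
  rewrite (s_cls1 cx1); have [k e] := class_diff c0 cx1.
  have -> : x = x0 + 1 + k * n%:Z by lia.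
  have -> : x0 + 1 + k * n%:Z - 1 = x0 + k * n%:Z by lia.
  rewrite !gp g1 sE.
  have c1 : in_class j (g x0 + k * n%:Z) by rewrite class_near // dvdz_mull.
  have -> : g x0 + 1 + k * n%:Z = g x0 + k * n%:Z + 1 by lia.
  rewrite [in_class j (_ + 1)]class_near // dvd1n.
  have -> : g x0 + k * n%:Z + 1 - 1 = g x0 + k * n%:Z by lia.
  by rewrite c1.
have nj : in_class j (g x) = false.
  apply/negP => h; have [k /gI ex] := clsj _ h; case/negP: cx; rewrite ex.
  by rewrite class_near // dvdz_mull.
have nj1 : in_class j (g x - 1) = false.
  apply/negP => h; have [k e] := clsj _ h.
  have : g x = g (x0 + 1 + k * n%:Z) by rewrite gp g1; move: e; rewrite gp; lia.
  move/gI => ex; case/negP: cx1; rewrite ex.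
  have -> : x0 + 1 + k * n%:Z - 1 = x0 + k * n%:Z by lia.
  by rewrite class_near // dvdz_mull.
by rewrite (s_ncls nj nj1) s_ncls //; apply: negbTE.
Qed.

(** s_i only reverses the order of adjacent pairs that it exchanges. *)
Lemma s_reverse i a b : a < b -> s i b < s i a -> in_class i a /\ b = a + 1.
Proof.
move=> ab; have := s_near i b => hb.
case: (boolP (in_class i a)) => ca; first by rewrite (s_cls ca) => lt; split=> //; lia.
by rewrite [s i a]sE (negbTE ca); case: ifP => _; lia.
Qed.
End Reflection.

Lemma word_act_rcons n (u : seq 'I_n) i x :
  word_act (rcons u i) x = word_act u (s i x).
Proof. by elim: u => //= j u ->. Qed.

Lemma word_actK n (u : seq 'I_n) : (1 < n)%N ->
  cancel (word_act u) (word_act (rev u)).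
Proof.
move=> n1; elim: u => //= i u IH x; rewrite rev_cons word_act_rcons sK //.
Qed.

Lemma word_actVK n (u : seq 'I_n) : (1 < n)%N ->
  cancel (word_act (rev u)) (word_act u).
Proof. by move=> n1 x; have := word_actK (rev u) n1 x; rewrite revK. Qed.

(** Apply the letters of v, first letter first, to the pair g x0 < g (x0 + 1):
    at the end the pair is reversed, so some letter reverses it. Deleting this
    letter amounts, by [s_conj], to inserting s_i. The permutation g is the
    product of the letters already passed. *)
Lemma exchange n (i : 'I_n) (v : seq 'I_n) (g : int -> int) x0 : (1 < n)%N ->
  injective g -> (forall x (k : int), g (x + k * n%:Z) = g x + k * n%:Z) ->
  in_class i x0 -> g x0 < g (x0 + 1) ->
  word_act (rev v) (g (x0 + 1)) < word_act (rev v) (g x0) ->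
  exists2 v' : seq 'I_n, (size v' < size v)%N &
    forall x y, word_act v y = g x -> word_act v' y = g (s i x).
Proof.
move=> n1; elim: v g => [|j v IH] g gI gp c0 lt; first by rewrite /=; lia.
rewrite rev_cons !word_act_rcons => gt.
have sI := can_inj (sK j n1).
case: (ltgtP (s j (g x0)) (s j (g (x0 + 1)))) => [lt'|gt'|/sI e].
- have gI' : injective (s j \o g) by move=> x y /= /sI /gI.
  have gp' x (k : int) : (s j \o g) (x + k * n%:Z) = (s j \o g) x + k * n%:Z.
    by rewrite /= gp s_periodic.
  have [v' sv' h] := IH (s j \o g) gI' gp' c0 lt' gt.
  exists (j :: v') => // x y /= e.
  by rewrite (h x) /= ?sK // -e sK.
- have [cj e1] := s_reverse n1 lt gt'.
  exists v => // x y /= e.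
  by rewrite -(s_conj n1 gI gp c0 cj e1) -e sK.
- by move: lt; rewrite e ltxx.
Qed.

Lemma reduced_imin n (i : 'I_n) (v : seq 'I_n) m : (1 < n)%N ->
  reduced_word (word_act (i :: v)) (i :: v) -> iminimal i (word_act v @` L m).
Proof.
move=> n1 [_ red] x cx [y ym ey].
exists (word_act (rev v) x); last by rewrite word_actVK.
have ey' : word_act (rev v) (x + 1) = y by rewrite -ey word_actK.
have [le|gt] := leP (word_act (rev v) x) (word_act (rev v) (x + 1)).
  by rewrite /L /=; apply: le_trans le _; rewrite ey'.
have lt : x < x + 1 by lia.
have [v' sv' h] := @exchange n i v id x n1 (fun _ _ => id)
  (fun _ _ => erefl) cx lt gt.
suff /red : word_act (i :: v) =1 word_act v'.
  by rewrite /= ltnNge (ltnW sv').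
by move=> z /=; rewrite (h (word_act v z)).
Qed.

(** * The roof as a right-to-left scan *)

(** Iterating [up] from J through sets that are not n-stable, together with
    what a move of one bead to the right preserves. *)
Definition climbs (n : nat) (J K : set int) : Prop :=
  exists l : nat, [/\ K = iter l (up n) J,
    forall l' : nat, (l' < l)%N -> ~ nstable n (iter l' (up n) J),
    count_le J K & forall m, charged J m -> charged K m].

Lemma climbs_refl n J : climbs n J J.
Proof. by exists 0%N; split=> //; apply: count_le_refl. Qed.

Lemma climbs_trans n J K M : climbs n J K -> climbs n K M -> climbs n J M.
Proof.
move=> [l [eK nsK dK cK]] [k [eM nsM dM cM]]; exists (k + l)%N; split.
- by rewrite iterD -eK.
- move=> j jkl; have [jl|lj] := ltnP j l; first exact: nsK.
  by rewrite -(subnK lj) iterD -eK; apply: nsM; lia.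
- exact: count_le_trans dK dM.
- by move=> m /cK /cM.
Qed.

Lemma climbs_swap n (J : set int) p q : ~ nstable n J -> up n J = swap J p q ->
  J p -> ~ J q -> p < q -> climbs n J (swap J p q).
Proof.
move=> ns e Jp Jq pq; exists 1%N; split=> //.
- by case.
- exact: count_le_swap.
- by move=> m cJ; apply: charged_swap.
Qed.

Lemma climbs_roof n J K : climbs n J K -> nstable n K -> roof n J = K.
Proof.
move=> [l [eK ns _ _]] sK; rewrite /roof.
have rK : is_roof n J K by exists l.
case: xgetP => [M -> [k [eM sM nsM]]|/(_ K)//].
case: (ltngtP k l) => [kl|lk|e]; last by rewrite eM eK e.
  by case: (ns _ kl); rewrite -eM.
by case: (nsM _ lk); rewrite -eK.
Qed.

(** Level k of runner d is the position x + 1 + d + k n. *)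
Definition conf (n : nat) (x : int) (h : seq nat) (J : set int) : set int :=
  [set y | (y <= x /\ J y) \/ exists d k : nat,
     [/\ (d < n)%N, (k < nth 0 h d)%N & y = x + 1 + (d + k * n)%:Z]].

(** The sets met while the gap at x is treated. The runner of x still holds
    the beads of levels k to b; W lists the heights of the other n - 1
    runners. *)
Definition mid (n : nat) (x : int) (b k : nat) (W : seq nat) (J : set int) :
    set int :=
  [set y | [\/ y < x /\ J y,
    exists2 l : nat, (k <= l <= b)%N & y = x + (l * n)%:Z |
    exists d l : nat, [/\ (d < n.-1)%N, (l < nth 0 W d)%N
      & y = x + 1 + (d + l * n)%:Z]]].

Section Mid.
Variable n : nat.
Hypothesis n1 : (1 < n)%N.
Variables (x : int) (b : nat) (J : set int).
Implicit Types (k l d : nat) (W : seq nat).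

Lemma runner_inj d d' l l' : (d < n)%N -> (d' < n)%N ->
  (d + l * n = d' + l' * n)%N -> d = d' /\ l = l'.
Proof.
move=> dn dn' e; have el : l = l'.
  have := congr1 (fun z => z %/ n)%N e.
  by rewrite !divnDMl ?divn_small ?add0n //; lia.
by split=> //; move: e; rewrite el => /addIn.
Qed.

Lemma mulSn_le l l' : (l < l')%N -> (l * n + n <= l' * n)%N.
Proof. by move=> h; rewrite -mulSnr leq_mul2r h orbT. Qed.

Lemma mid_col k W d l : (d < n.-1)%N ->
  mid n x b k W J (x + 1 + (d + l * n)%:Z) <-> (l < nth 0 W d)%N.
Proof.
move=> dn; split=> [[[h _]|[l' _ e]|[d' [l' [dn' lt e]]]]|lt].
- by lia.
- have [|||? ?] := @runner_inj d.+1 0 l l'; [lia|lia|lia|lia].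
- have [|||ed el] := @runner_inj d d' l l'; [lia|lia|lia|idtac].
  by rewrite ed el.
by apply: Or33; exists d, l.
Qed.

Lemma mid_base k W l : (0 < k)%N ->
  mid n x b k W J (x + (l * n)%:Z) <-> (k <= l <= b)%N.
Proof.
move=> k0; split=> [[[h _]|[l' h e]|[d' [l' [dn' lt e]]]]|h].
- by lia.
- have [|||_ el] := @runner_inj 0 0 l l'; [lia|lia|lia|idtac].
  by rewrite el.
- have [|||? ?] := @runner_inj 0 d'.+1 l l'; [lia|lia|lia|lia].
by apply: Or32; exists l.
Qed.

Lemma mid_low k W y : y < x -> mid n x b k W J y <-> J y.
Proof.
move=> yx; split=> [[[_ //]|[l' h e]|[d' [l' [dn' lt e]]]]|h]; try by lia.
by apply: Or31.
Qed.

Lemma runnerP y : [\/ y < x, exists l, y = x + (l * n)%:Z |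
  exists d l, (d < n.-1)%N /\ y = x + 1 + (d + l * n)%:Z].
Proof.
case: (ltP y x) => yx; first exact: Or31.
have ey := divn_eq `|y - x| n.
have := ltn_pmod `|y - x| (ltnW n1).
case: (`|y - x| %% n)%N ey => [|d] ey dn.
  by apply: Or32; exists (`|y - x| %/ n)%N; lia.
by apply: Or33; exists d, (`|y - x| %/ n)%N; split; lia.
Qed.

(** One use of [up]. The bead p is the one of level k above the gap: every
    higher bead is supported. A candidate q is the first free position of
    another runner; it lies right of p exactly if its level is at least k, and
    positions are ordered by level first and distance to x second. *)
Lemma up_mid k A m B : (0 < k <= b)%N -> (k <= m)%N ->
  size (A ++ m :: B) = n.-1 ->
  all (fun t => (t < k) || (m < t))%N A ->
  all (fun t => (t < k) || (m <= t))%N B ->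
  climbs n (mid n x b k (A ++ m :: B) J) (mid n x b k.+1 (A ++ m.+1 :: B) J).
Proof.
move=> /andP[k0 kb] km sW hA hB; set W := A ++ m :: B; set W' := A ++ _.
set d0 := size A.
have d0n : (d0 < n.-1)%N by rewrite -sW size_cat /=; lia.
have eWd0 : nth 0%N W d0 = m by rewrite nth_cat ltnn subnn.
have eW'd0 : nth 0%N W' d0 = m.+1 by rewrite nth_cat ltnn subnn.
have eWd d : d <> d0 -> nth 0%N W' d = nth 0%N W d.
  move=> ne; rewrite !nth_cat; case: ltnP => // h.
  by have -> : (d - d0 = (d - d0).-1.+1)%N by lia.
set K := mid n x b k W J.
pose p := x + (k * n)%:Z; pose q := x + 1 + (d0 + m * n)%:Z.
have Kp : K p by apply/mid_base => //; rewrite leqnn.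
have Kq : ~ K q by move/(mid_col _ _ _ d0n); rewrite eWd0 ltnn.
have pq : p < q by have := leq_mul km (leqnn n); rewrite /p /q; lia.
have predbase l : (0 < l)%N -> x + (l * n)%:Z - n%:Z = x + (l.-1 * n)%:Z.
  by case: l => //= l _; rewrite mulSn; lia.
have predcol d l : (0 < l)%N ->
    x + 1 + (d + l * n)%:Z - n%:Z = x + 1 + (d + l.-1 * n)%:Z.
  by case: l => //= l _; rewrite mulSn; lia.
have Kpn : ~ K (p - n%:Z).
  by rewrite predbase // => /(mid_base _ _ k0); lia.
have ep : zmax [set p' | K p' /\ ~ K (p' - n%:Z)] = p.
  apply: zmaxE => // y [Ky nKy].
  case: (runnerP y) => [yx|[l ey]|[d [l [dn ey]]]].
  - by rewrite /p; lia.
  - move: Ky; rewrite ey => /(mid_base _ _ k0) /andP[kl lb].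
    have [lk|lk] := ltnP k l; last first.
      by have -> : l = k by lia.
    case: nKy; rewrite ey predbase; last by lia.
    by apply/(mid_base _ _ k0); lia.
  - case: l ey => [|l] ey.
      have := leq_mul k0 (leqnn n); rewrite /p; lia.
    move: Ky; rewrite ey => /(mid_col _ _ _ dn) lt.
    case: nKy; rewrite ey predcol //; apply/(mid_col _ _ _ dn).
    by rewrite /=; lia.
have eq : zmin [set q' | [/\ p < q', ~ K q', K (q' - n%:Z)
                            & (q' <> p %[mod n%:Z])%Z]] = q.
  apply: zminE.
    split=> //.
      have m0 : (0 < m)%N by lia.
      by rewrite predcol //; apply/(mid_col _ _ _ d0n); rewrite eWd0; lia.
    move/eqP; rewrite eqz_mod_dvd.
    have -> : q - p = d0.+1%:Z + (m - k)%N%:Z * n%:Z.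
      have emk : (m - k)%N%:Z = m%:Z - k%:Z by lia.
      by rewrite emk /q /p; lia.
    rewrite rpredDr ?dvdz_mull // dvdzE /= => /dvdn_leq /= -/(_ isT).
    by lia.
  move=> y [py nKy Kyn ny].
  have nk : (n <= k * n)%N by rewrite leq_pmull.
  case: (runnerP y) => [yx|[l ey]|[d [l [dn ey]]]].
  - by move: py; rewrite /p; lia.
  - case: ny; apply/eqP; rewrite eqz_mod_dvd ey /p.
    have -> : x + (l * n)%:Z - (x + (k * n)%:Z) = (l%:Z - k%:Z) * n%:Z by lia.
    exact: dvdz_mull.
  case: l ey => [|l] ey; first by move: py; rewrite /p ey; lia.
  move: Kyn; rewrite ey predcol // => /(mid_col _ _ _ dn) /= lt.
  have ge : (nth 0%N W d <= l.+1)%N.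
    rewrite leqNgt; apply/negP => h; apply: nKy; rewrite ey.
    exact/(mid_col _ _ _ dn).
  have ed : nth 0%N W d = l.+1 by lia.
  have kl : (k <= l.+1)%N.
    rewrite leqNgt; apply/negP => /mulSn_le; move: py; rewrite /p ey; lia.
  rewrite /q; case: (ltngtP d d0) => dd.
  - move: ed; rewrite /W nth_cat dd => ed.
    have : nth 0%N A d \in A by exact: mem_nth.
    move/(allP hA); rewrite ed => h; have /mulSn_le : (m < l.+1)%N by lia.
    by lia.
  - have e2 : nth 0%N B (d - d0).-1 = l.+1.
      rewrite -ed /W nth_cat ltnNge (ltnW dd) /=.
      by have -> : (d - size A = (d - d0).-1.+1)%N by rewrite /d0 in dd *; lia.
    have : nth 0%N B (d - d0).-1 \in B.
      apply: mem_nth; have := congr1 size (erefl W); rewrite {1}sW size_cat /=.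
      by rewrite /d0 in dd *; lia.
    move/(allP hB); rewrite e2 => h.
    have /leq_mul/(_ (leqnn n)) : (m <= l.+1)%N by lia.
    by lia.
  - by move: ed; rewrite dd eWd0 => ->.
have eup : up n K = swap K p q by rewrite /up ep eq.
suff <- : swap K p q = mid n x b k.+1 W' J.
  by apply: climbs_swap => // st; apply/Kpn/st.
suff H y : swap K p q y <-> mid n x b k.+1 W' J y.
  by apply/seteqP; split=> y /H.
rewrite swapE /K.
have kq0 : q <> p by move=> e; move: pq; rewrite e ltxx.
case: (runnerP y) => [yx|[l ey]|[d [l [dn ey]]]].
- rewrite !mid_low //; split=> [[[Jy _] //|e]|Jy].
    by move: yx; rewrite e /q; lia.
  by left; split=> // e; move: yx; rewrite e /p; lia.
- rewrite ey !mid_base //; split=> [[[h ne]|e]|h].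
  + have : l <> k by move=> e; apply: ne; rewrite e.
    by lia.
  + have [|||? ?] := @runner_inj 0 d0.+1 l m; rewrite /q in e; [lia|lia|lia|lia].
  + left; split; first by lia.
    by rewrite /p => e; have [|||? ?] := @runner_inj 0 0 l k; lia.
rewrite ey !mid_col //; split=> [[[h ne]|e]|h].
- have [ed|ed] := eqVneq d d0; last by rewrite eWd //; apply/eqP.
  by move: h; rewrite ed eWd0 eW'd0; lia.
- have [|||-> ->] := @runner_inj d d0 l m; rewrite /q in e; [lia|lia|lia|idtac].
  by rewrite eW'd0.
have [ed|ed] := eqVneq d d0; last first.
  rewrite eWd in h; last exact/eqP.
  left; split=> // e.
  by have [|||? ?] := @runner_inj d.+1 0 l k; rewrite /p in e; lia.
move: h; rewrite ed eW'd0 ltnS leq_eqVlt => /orP[/eqP->|h]; first by right.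
left; rewrite eWd0; split=> // e.
have [|||? ?] := @runner_inj d0.+1 0 l k; rewrite /p in e; lia.
Qed.
End Mid.

Section Scan.
Variable n : nat.
Hypothesis n1 : (1 < n)%N.
Variable J : set int.
Implicit Types (x : int) (b k l d : nat) (W h : seq nat).

Lemma climbs_run x b k c W : (0 < k)%N -> (k + c = b.+1)%N -> size W = n.-1 ->
  has (leq k) W ->
  climbs n (mid n x b k W J) (mid n x b b.+1 (run k c W) J).
Proof.
elim: c k W => [|c IH] k W k0 kc sW al.
  by rewrite -kc addn0; apply: climbs_refl.
case: (placeP k W) => [dW|[A [m [B [eW km hA hB]]]]].
  by case/hasP: al => t /(allP dW); lia.
apply: (climbs_trans (K := mid n x b k.+1 (place k W) J)).
  by rewrite {2}eW placeE // eW; apply: up_mid => //; [lia | rewrite -eW].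
apply: IH => //; rewrite ?size_place //; first by lia.
by rewrite eW placeE // has_cat /= ltnS km orbT.
Qed.

Lemma conf_gap x b W : ~ J x -> size W = n.-1 ->
  conf n x (rcons W b) J = mid n x b 1 W J.
Proof.
move=> nJ sW; apply/seteqP; split=> y.
  move=> [[yx Jy]|[d [l [dn lt ->]]]].
    apply: Or31; split=> //; rewrite lt_neqAle yx andbT.
    by apply/eqP => e; apply: nJ; rewrite -e.
  move: lt; rewrite nth_rcons sW; case: (ltnP d n.-1) => dn1 lt.
    by apply: Or33; exists d, l.
  have ed : d = n.-1 by lia.
  apply: Or32; exists l.+1; first by move: lt; rewrite ed eqxx.
  by rewrite ed mulSn; lia.
move=> [[yx Jy]|[[|l] lb ->]|[d [l [dn lt ->]]]] //.
- by left; split=> //; apply: ltW.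
- right; exists n.-1, l; split; first by lia.
    by rewrite nth_rcons sW ltnn eqxx; lia.
  by rewrite mulSn; lia.
- right; exists d, l; split=> //; first by lia.
  by rewrite nth_rcons sW dn.
Qed.

Lemma mid_done x b W : size W = n.-1 ->
  mid n x b b.+1 W J = conf n (x - 1) (0%N :: W) J.
Proof.
move=> sW; apply/seteqP; split=> y.
  move=> [[yx Jy]|[l lb _]|[d [l [dn lt ->]]]].
  - by left; split=> //; lia.
  - by lia.
  - by right; exists d.+1, l; split=> //; lia.
move=> [[yx Jy]|[[|d] [l [dn lt ->]]]] //.
  by apply: Or31; split=> //; lia.
by apply: Or33; exists d, l; split=> //; lia.
Qed.

Lemma conf_bead x b W : J x -> size W = n.-1 ->
  conf n x (rcons W b) J = conf n (x - 1) (b.+1 :: W) J.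
Proof.
move=> Jx sW; apply/seteqP; split=> y.
  move=> [[yx Jy]|[d [l [dn lt ->]]]].
    have [e|ne] := eqVneq y x.
      by right; exists 0%N, 0%N; split=> //; rewrite ?e; lia.
    by left; split=> //; lia.
  move: lt; rewrite nth_rcons sW; case: (ltnP d n.-1) => dn1 lt.
    by right; exists d.+1, l; split=> //; lia.
  have ed : d = n.-1 by lia.
  right; exists 0%N, l.+1; split; first by lia.
    by move: lt; rewrite ed eqxx.
  by rewrite ed mulSn; lia.
move=> [[yx Jy]|[[|d] [l [dn lt ->]]]].
- by left; split=> //; lia.
- case: l lt => [|l] lt.
    by left; split; [lia | have -> : x - 1 + 1 + (0 + 0 * n)%:Z = x by lia].
  right; exists n.-1, l; split; first by lia.
    by rewrite nth_rcons sW ltnn eqxx.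
  by rewrite mulSn; lia.
- right; exists d, l; split=> //; try lia.
  by rewrite nth_rcons sW ifT //; lia.
Qed.

(** [scan x0 l] is the list of heights when the positions x0, ..., x0 - l + 1
    have been treated. *)
Fixpoint scan (x0 : int) (l : nat) : seq nat :=
  if l is l'.+1 then step `[< J (x0 - l'%:Z) >] (scan x0 l') else nseq n 0%N.

Lemma size_scan x0 l : size (scan x0 l) = n.
Proof.
elim: l => [|l IH] /=; first by rewrite size_nseq.
by rewrite size_step // -size_eq0 IH; lia.
Qed.

(** Dispersing a column neither fills an empty runner nor empties another one,
    so emptiness of a runner can be read from J at its lowest position. *)
Lemma scan_eq0 x0 l e : (forall y, x0 < y -> ~ J y) -> (e < n)%N ->
  (nth 0%N (scan x0 l) e == 0%N) = ~~ `[< J (x0 - l%:Z + 1 + e%:Z) >].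
Proof.
move=> up; elim: l e => [|l IH] e en /=.
  by rewrite nth_nseq en asboolF //; apply: up; lia.
rewrite step_eq0 -?size_eq0 ?size_scan; last by lia.
case: e en => [|e] en.
  by congr (~~ `[< J _ >]); lia.
rewrite leqNgt en /= IH; last by lia.
by congr (~~ `[< J _ >]); lia.
Qed.

(** Since J is n-bounded, a gap below a bead at distance n has another bead in
    between, so there is always a runner to receive the dispersed beads. *)
Lemma climbs_scan x0 l : (forall y, x0 < y -> ~ J y) -> linked n J ->
  climbs n J (conf n (x0 - l%:Z) (scan x0 l) J).
Proof.
move=> up w; elim: l => [|l IH] /=.
  have -> : conf n (x0 - 0%:Z) (nseq n 0%N) J = J; last exact: climbs_refl.
  rewrite subr0; apply/seteqP; split=> y.
    by move=> [[]//|[d [k [dn]]]]; rewrite nth_nseq dn.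
  by move=> Jy; left; split=> //; rewrite leNgt; apply/negP => /up.
apply: climbs_trans IH _.
have ex : x0 - l.+1%:Z = x0 - l%:Z - 1 by lia.
have nz e := @scan_eq0 x0 l e up; have sz := size_scan x0 l.
rewrite ex; case/lastP: (scan x0 l) sz nz => [|W b]; first by move=> /=; lia.
rewrite size_rcons step_rcons => sz nz.
have sW : size W = n.-1 by lia.
set x := x0 - l%:Z in nz *.
have [Jx|nJx] := pselect (J x).
  by rewrite asboolT // conf_bead //; apply: climbs_refl.
rewrite asboolF // conf_gap // -(@mid_done x b) ?size_run //.
case: b nz => [|b] nz; first exact: climbs_refl.
apply: climbs_run => //.
have Jt : J (x + n%:Z).
  have := nz n.-1; rewrite nth_rcons sW ltnn eqxx /= => /(_ _)/esym/negbFE.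
  move=> /(_ _)/asboolP.
  by have -> : x + 1 + n.-1%:Z = x + n%:Z; [lia|apply; lia].
have [y [Jy yt ty]] := w _ Jt.
have yx : x < y.
  rewrite lt_neqAle; apply/andP; split; last by lia.
  by apply/eqP => e; apply: nJx; rewrite e.
pose e := `|(y - x - 1)%R|%N; have en : (e < n.-1)%N by rewrite /e; lia.
have := nz e; rewrite nth_rcons sW en.
have -> : x + 1 + e%:Z = y by rewrite /e; lia.
rewrite asboolT //= => /(_ _) h; apply/hasP; exists (nth 0%N W e).
  by apply: mem_nth; rewrite sW.
by rewrite lt0n h //; lia.
Qed.

Lemma nstable_conf x h : (forall y, y <= x -> J y) -> nstable n (conf n x h J).
Proof.
move=> full y [[yx Jy]|[d [[|l] [dn lt ->]]]].
- by left; split; [lia | apply: full; lia].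
- by left; split; [lia | apply: full; lia].
- by right; exists d, l; split=> //; [lia | rewrite mulSn; lia].
Qed.

Lemma roof_scan x0 l : (forall y, x0 < y -> ~ J y) -> linked n J ->
  (forall y, y <= x0 - l%:Z -> J y) ->
  roof n J = conf n (x0 - l%:Z) (scan x0 l) J.
Proof.
move=> up w full; apply: climbs_roof (climbs_scan _ up w) _.
exact: nstable_conf.
Qed.
End Scan.

Lemma conf_full n x h J J' : (forall y, y <= x -> J y) ->
  (forall y, y <= x -> J' y) -> conf n x h J = conf n x h J'.
Proof.
move=> f f'; apply/seteqP; split=> y [[yx _]|H]; try by right.
  by left; split=> //; apply: f'.
by left; split=> //; apply: f.
Qed.

Lemma class_conf n (i : 'I_n) x d l : (1 < n)%N -> in_class i (x + 1) ->
  (d < n)%N -> in_class i (x + 1 + (d + l * n)%:Z) = (d == 0%N).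
Proof.
move=> n1 cx dn; rewrite class_near // PoszD rpredDr ?PoszM ?dvdz_mull //.
rewrite dvdzE /=; case: d dn => [|d] dn; first by rewrite dvdn0.
by apply/negP => /dvdn_leq -/(_ isT); lia.
Qed.

Lemma imin_conf n (i : 'I_n) x h (J : set int) : (1 < n)%N ->
  in_class i (x + 1) -> (forall y, y <= x -> J y) -> descent 0 h -> iminimal i (conf n x h J).
Proof.
move=> n1 cx full de y cy [[yx Jy]|[[|d] [l [dn lt e]]]].
- by left; split; [lia | apply: full; lia].
- have := class_conf l n1 cx dn; rewrite -e.
  by rewrite class_succ.
- have ey : y = x + 1 + (d + l * n)%:Z by lia.
  have := class_conf l n1 cx (ltnW dn); rewrite -ey cy => /esym/eqP d0.
  right; exists d, l; split=> //; first exact: ltnW.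
  by move: lt; rewrite d0 => lt; apply: leq_trans de.
Qed.

Lemma image_conf n (i : 'I_n) x a b W (J : set int) : (1 < n)%N ->
  in_class i (x + 1) -> (forall y, y <= x -> J y) ->
  s i @` conf n x (a :: b :: W) J = conf n x (b :: a :: W) J.
Proof.
move=> n1 cx full; apply/seteqP.
suff H a' b' y : conf n x (a' :: b' :: W) J y ->
    conf n x (b' :: a' :: W) J (s i y).
  split=> [_ [y /H h <-//]|y /H h].
  by exists (s i y) => //; rewrite sK.
move=> [[yx Jy]|[d [l [dn lt ey]]]].
  left; suff : s i y <= x by move=> h; split=> //; apply: full.
  have := s_near n1 i y; rewrite sE //; case: ifP => cy.
    2: by case: ifP => _; lia.
  have [e|ne] := eqVneq y x; last by lia.
  by have := class_pred n1 cx; rewrite addrK -e cy.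
have cd := class_conf l n1 cx dn; rewrite -ey in cd.
right; case: d cd dn lt ey => [|d] cd dn lt ey.
  by exists 1%N, l; split=> //; rewrite s_cls //; lia.
have ey1 : y - 1 = x + 1 + (d + l * n)%:Z by lia.
have cd1 := class_conf l n1 cx (ltnW dn); rewrite -ey1 in cd1.
case: d cd cd1 dn lt ey ey1 => [|d] cd cd1 dn lt ey ey1.
  by exists 0%N, l; split; [lia | exact: lt | rewrite s_cls1 //; lia].
by exists d.+2, l; split=> //; rewrite s_ncls.
Qed.

(** * Signatures and the effect of a lowering operator on the scan *)

Definition period_count (n : nat) (J : set int) (x : int) (l : nat) : nat :=
  (\sum_(t < l) `[< J (x + n%:Z * t%:Z)%R >])%N.

(** No bead of class i + 1 at or above x (congruent to i) is left unmatched
    when each is matched with beads of class i between it and x. *)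
Definition balanced (n : nat) (J : set int) (x : int) : Prop :=
  forall l, (period_count n J (x + 1) l <= period_count n J x l)%N.

Section Signature.
Variable n : nat.
Hypothesis n1 : (1 < n)%N.
Implicit Types (i : 'I_n) (J : set int) (x r : int).

Lemma period_count0 J x : period_count n J x 0 = 0%N.
Proof. by rewrite /period_count big_ord0. Qed.

Lemma period_countS J x l :
  period_count n J x l.+1 = (`[< J x >] + period_count n J (x + n%:Z) l)%N.
Proof.
rewrite /period_count big_ord_recl /= mulr0 addr0; congr addn; apply: eq_bigr => t _.
by congr (nat_of_bool `[< J _ >]); rewrite /bump /=; lia.
Qed.

Lemma period_countD J x l k : period_count n J x (l + k) =
  (period_count n J x l + period_count n J (x + (l * n)%:Z) k)%N.
Proof.
elim: l x => [|l IH] x; first by rewrite period_count0 mul0n addr0.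
rewrite addSn !period_countS IH addnA; congr (_ + period_count n J _ _)%N; lia.
Qed.

Lemma period_count_ext J J' x l : (forall t : nat, (t < l)%N ->
    J (x + (t * n)%:Z) <-> J' (x + (t * n)%:Z)) ->
  period_count n J x l = period_count n J' x l.
Proof.
move=> e; apply: eq_bigr => t _; congr nat_of_bool; apply: asbool_equiv_eq.
by have -> : n%:Z * t%:Z = (t * n)%:Z; [lia | apply: e].
Qed.

Lemma count_mod_period_count J r k a r0 l : (r0 = a %[mod n%:Z])%Z ->
  r0 - n%:Z < r <= r0 -> k < r0 + (l * n)%:Z <= k + n%:Z ->
  count_mod n J r k a = period_count n J r0 l.
Proof.
move=> ea r0r kl.
have [|_ e] := @zcard_progression J r0 n%:Z l; first by lia.
rewrite /count_mod /period_count -e; congr zcard; apply/seteqP; split=> j.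
  move=> [Jj rj jk]; rewrite -ea => /eqP; rewrite eqz_mod_dvd => /dvdzP[c ec].
  split=> //; have c0 : 0 <= c by nia.
  by exists `|c|%N; [nia | lia].
move=> [Jj [t tl ej]]; split=> //; [nia|nia|].
rewrite -ea; apply/eqP; rewrite eqz_mod_dvd ej.
by have -> : r0 + n%:Z * t%:Z - r0 = t%:Z * n%:Z; [lia | apply: dvdz_mull].
Qed.

(** For r congruent to i, the condition that defines the set R of the lowering
    operator, with k restricted to one value per period ([lowerRP]). *)
Definition unmatched J r : Prop :=
  forall l, (period_count n J (r + 1) l.+1 < period_count n J r l.+1)%N.

Lemma lowerRP i J r : lowerR i J r <-> in_class i r /\ unmatched J r.
Proof.
have mod1 : in_class i r -> (r + 1 = i%:Z + 1 %[mod n%:Z])%Z.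
  move=> cr; apply/eqP; rewrite eqz_mod_dvd.
  have -> : r + 1 - (i%:Z + 1) = r - i%:Z by lia.
  by rewrite -class_dvd.
split=> [H|[cr H] k rk].
  have cr : in_class i r.
    apply/negPn/negP => ncr; have := H r (lexx r).
    suff -> : count_mod n J r r i%:Z = 0%N by [].
    rewrite /count_mod -zcard0; congr zcard.
    apply/seteqP; split=> j // [_ rj jr /eqP].
    by have -> : j = r; [lia | move=> h; case/negP: ncr].
  split=> // l; have := H (r + (1 + l * n)%:Z).
  rewrite (@count_mod_period_count J r _ _ (r + 1) l.+1).
  - rewrite (@count_mod_period_count J r _ _ r l.+1) //; [|exact/eqP|lia|lia].
    by apply; lia.
  - exact: mod1.
  - by lia.
  - by lia.
have [s [t [sn ek]]] : exists s t, (s < n)%N /\ k = r + (s + t * n)%:Z.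
  exists (`|(k - r)%R| %% n)%N, (`|(k - r)%R| %/ n)%N; split.
    by rewrite ltn_pmod //; lia.
  by have := divn_eq `|(k - r)%R| n; lia.
rewrite (@count_mod_period_count J r k i%:Z r t.+1); [|exact/eqP|lia|lia].
case: s sn ek => [|s] sn ek.
  rewrite (@count_mod_period_count J r k _ (r + 1) t); [|exact: mod1|lia|lia].
  apply: leq_ltn_trans (H t).
  by rewrite -[t.+1]addn1 period_countD leq_addr.
rewrite (@count_mod_period_count J r k _ (r + 1) t.+1).
- exact: H.
- exact: mod1.
- by lia.
- by lia.
Qed.

(** An unmatched bead of class i has a gap next to it, and beyond that all
    beads of class i + 1 are matched. *)
Lemma unmatchedP J r :
  unmatched J r <-> [/\ J r, ~ J (r + 1) & balanced n J (r + n%:Z)].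
Proof.
have e : r + 1 + n%:Z = r + n%:Z + 1 by lia.
split=> [H|[Jr nJr u] l].
  have := H 0%N; rewrite !period_countS !period_count0 !addn0.
  case: (asboolP (J r)) => Jr; case: (asboolP (J (r + 1))) => Jr1 //= _.
  split=> // l; case: l => [|l]; first by rewrite !period_count0.
  by have := H l.+1; rewrite period_countS (period_countS J r) asboolF //
    asboolT // e add0n add1n ltnS.
by rewrite !period_countS asboolF // asboolT // e add0n add1n ltnS.
Qed.

Lemma balanced_unmatched J r : unmatched J r -> balanced n J r.
Proof. by move=> H [|l]; [rewrite !period_count0 | apply/ltnW/H]. Qed.

Lemma balanced_pair J r : balanced n J (r + n%:Z) -> (J (r + 1) -> J r) ->
  balanced n J r.
Proof.
move=> u h [|l]; first by rewrite !period_count0.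
rewrite !period_countS; have -> : r + 1 + n%:Z = r + n%:Z + 1 by lia.
apply: leq_add (u l).
by have := asbool_implyb h; do 2!case: asbool.
Qed.

Lemma balanced_imply J r : balanced n J r -> J (r + 1) -> J r.
Proof.
move=> u J1; have := u 1%N; rewrite !period_countS !period_count0 (asboolT J1).
by case: asboolP.
Qed.

Lemma balanced_up J r : balanced n J r -> (J r -> J (r + 1)) ->
  balanced n J (r + n%:Z).
Proof.
move=> u h l; have := u l.+1; have := balanced_imply u; rewrite !period_countS.
have -> : r + 1 + n%:Z = r + n%:Z + 1 by lia.
move=> h'; have := asbool_implyb h; have := asbool_implyb h'.
by do 2!case: asbool => //=; rewrite ?leq_add2l.
Qed.

Lemma balanced_ext J J' x : (forall y, x <= y -> J y <-> J' y) ->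
  balanced n J x -> balanced n J' x.
Proof.
move=> e u l; rewrite -!(@period_count_ext J J') //.
  by move=> t _; apply: e; lia.
by move=> t _; apply: e; lia.
Qed.

Lemma scan_ext J J' x0 l : (forall t : nat, (t < l)%N ->
  J (x0 - t%:Z) <-> J' (x0 - t%:Z)) -> scan n J x0 l = scan n J' x0 l.
Proof.
elim: l => //= l IH e; rewrite IH; last by move=> t tl; apply: e; lia.
by congr (step _ _); apply: asbool_equiv_eq; apply: e.
Qed.

Lemma scan_descent J x0 l k : (k.+1 < n)%N -> descent 0 (scan n J x0 l) ->
  descent k (scan n J x0 (k + l)).
Proof.
move=> kn d; elim: k kn => //= k IH kn.
apply: step_descent; last exact: IH (ltnW kn).
by rewrite size_scan.
Qed.

Lemma scan_swapped J J' x0 l k : (k.+1 < n)%N ->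
  (forall t : nat, (t < k)%N -> J (x0 - (t + l)%:Z) <-> J' (x0 - (t + l)%:Z)) ->
  swapped 0 (scan n J x0 l) (scan n J' x0 l) ->
  swapped k (scan n J x0 (k + l)) (scan n J' x0 (k + l)).
Proof.
move=> kn e d; elim: k kn e => //= k IH kn e.
have <- : `[< J (x0 - (k + l)%:Z) >] = `[< J' (x0 - (k + l)%:Z) >].
  by apply: asbool_equiv_eq; apply: e.
apply: step_swapped; first by rewrite size_scan.
by apply: IH (ltnW kn) _ => t tk; apply: e; lia.
Qed.

Lemma pair_end (h : seq nat) : size h = n ->
  exists W a b, h = rcons (rcons W a) b /\ size W = (n - 2)%N.
Proof.
case/lastP: h => [|h b]; first by move=> /=; lia.
case/lastP: h => [|W a]; first by move=> /=; lia.
by rewrite !size_rcons => e; exists W, a, b; split=> //; lia.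
Qed.

Lemma swapped_end (h h' : seq nat) : size h = n -> swapped (n - 2) h h' ->
  h = h' \/ exists W a b, h = rcons (rcons W a) b /\ h' = rcons (rcons W b) a.
Proof.
move=> sh [->|[A [x [y [B [sA eh eh']]]]]]; first by left.
right; exists A, x, y; rewrite eh eh' -!cats1 -!catA.
have -> : B = [::]; last by [].
by apply: size0nil; move: sh; rewrite eh size_cat /= sA; lia.
Qed.

Lemma descent_end W a b : size W = (n - 2)%N ->
  descent (n - 2) (rcons (rcons W a) b) -> (b <= a)%N.
Proof.
move=> sW; rewrite /descent !nth_rcons !size_rcons sW.
by rewrite ltnn eqxx ltnSn ltnn eqxx.
Qed.

Lemma scan_period J x0 m : scan n J x0 (m.+1 * n) =
  step `[< J (x0 + 1 - (m.+1 * n)%:Z) >]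
    (step `[< J (x0 + 1 - (m.+1 * n)%:Z + 1) >] (scan n J x0 (n - 2 + m * n))).
Proof.
have -> : (m.+1 * n = (n - 2 + m * n).+2)%N by rewrite mulSn; lia.
rewrite /=; congr (step `[< J _ >] (step `[< J _ >] _)); lia.
Qed.

(** The entry of i + 1 can exceed the entry of i only if the last pair that
    was not made of two beads had a bead at i + 1 only; balance at the current
    point excludes this. *)
Lemma balanced_descent J x0 m : (forall y, x0 < y -> ~ J y) ->
  balanced n J (x0 + 1 - (m * n)%:Z) -> descent 0 (scan n J x0 (m * n)).
Proof.
move=> up; elim: m => [|m IH] u.
  by rewrite /descent mul0n /= !nth_nseq; do 2!case: ifP.
have en : x0 + 1 - (m.+1 * n)%:Z + n%:Z = x0 + 1 - (m * n)%:Z.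
  by rewrite mulSn; lia.
rewrite scan_period; set r := x0 + 1 - (m.+1 * n)%:Z in u en *.
have [W [a [b [eh sW]]]] := pair_end (size_scan n1 J x0 (n - 2 + m * n)).
rewrite eh; have := balanced_imply u.
case: (asboolP (J r)) => Jr; case: (asboolP (J (r + 1))) => Jr1 h.
- have ur : balanced n J (x0 + 1 - (m * n)%:Z) by rewrite -en; apply: balanced_up.
  have := @scan_descent J x0 (m * n) (n - 2); rewrite eh => /(_ _ (IH ur)) d.
  by rewrite step_both /descent /= ltnS; apply: (descent_end sW); apply: d; lia.
- by have [c [W' ->]] := step_left W a b.
- by case: Jr; apply: h.
- by rewrite step_neither.
Qed.

(** The graph of f_i with the moved bead r made explicit ([lower_lowers],
    [lowers_lower]). *)
Definition lowers i (J : set int) (r : int) (J' : set int) : Prop :=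
  [/\ lowerR i J r, (forall r', lowerR i J r' -> r <= r') & J' = swap J r (r + 1)].

(** The scans of J and of its image under f_i, stopped after each full period
    below the moved bead. Balance is carried along because it makes a bead at
    i next to a gap at i + 1 unmatched, which the minimality of r forbids. *)
Lemma scan_lowers i J r J' x0 m0 m : lowers i J r J' ->
  (forall y, x0 < y -> ~ J y) ->
  r = x0 + 1 - (m0.+1 * n)%:Z ->
  scan n J x0 ((m0 + m).+1 * n) = scan n J' x0 ((m0 + m).+1 * n) \/
  (swapped 0 (scan n J x0 ((m0 + m).+1 * n)) (scan n J' x0 ((m0 + m).+1 * n)) /\
   balanced n J (x0 + 1 - ((m0 + m).+1 * n)%:Z)).
Proof.
move=> [/lowerRP[cr ur] mn eJ] up er.
have [Jr nJr1 u] := (unmatchedP J r).1 ur.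
have same y : y <> r -> y <> r + 1 -> J y <-> J' y.
  move=> yr yr1; rewrite eJ swapE; split=> [Jy|[[]|]//]; by left.
have nJ'r : ~ J' r by rewrite eJ swapE => -[[]//|]; lia.
have J'r1 : J' (r + 1) by rewrite eJ swapE; right.
elim: m => [|m IH].
  right; rewrite addn0 -er; split; last exact: balanced_unmatched.
  rewrite !scan_period -er -(@scan_ext J J') => [|t tl]; last first.
    by apply: same; move: tl; rewrite er mulSn; lia.
  have en : r + n%:Z = x0 + 1 - (m0 * n)%:Z by rewrite er mulSn; lia.
  have [W [a [b [eh sW]]]] := pair_end (size_scan n1 J x0 (n - 2 + m0 * n)).
  (* All i + 1 above r are matched since r is unmatched. *)
  have ba : (b <= a)%N.
    apply: (descent_end sW); rewrite -eh; apply: scan_descent; first by lia.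
    by apply: balanced_descent; rewrite // -en.
  rewrite eh (asboolT Jr) (asboolF nJr1) (asboolF nJ'r) (asboolT J'r1).
  have [c [W' [-> ->]]] := step_left_right W ba.
  by right; exists [::], c, 0%N, W'.
rewrite addnS; set M := (m0 + m).+1 in IH *.
pose z := x0 + 1 - (M.+1 * n)%:Z.
have zr : z + 1 < r.
  rewrite /z er /M !mulSn; have := leq_addr (m * n) (m0 * n).
  by rewrite -mulnDl; lia.
have zn : z + n%:Z = x0 + 1 - (M * n)%:Z by rewrite /z mulSn; lia.
have same' t : (t + M * n < M.+1 * n)%N ->
    J (x0 - (t + M * n)%:Z) <-> J' (x0 - (t + M * n)%:Z).
  move=> tl; apply: same; move: tl zr; rewrite /z er /M !mulSn mulnDl; lia.
rewrite !scan_period -/z.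
have <- : `[< J z >] = `[< J' z >] by apply: asbool_equiv_eq; apply: same; lia.
have <- : `[< J (z + 1) >] = `[< J' (z + 1) >].
  by apply: asbool_equiv_eq; apply: same; lia.
have sw : swapped 0 (scan n J x0 (M * n)) (scan n J' x0 (M * n)).
  by case: IH => [->|[]//]; left.
have sw2 : swapped (n - 2) (scan n J x0 (n - 2 + M * n))
    (scan n J' x0 (n - 2 + M * n)).
  apply: scan_swapped sw; first by lia.
  by move=> t tn; apply: same'; rewrite mulSn; lia.
case: IH => [e|[_ uz]].
  left; congr (step _ (step _ _)).
  have ext k : (k <= n)%N -> scan n J x0 (k + M * n) = scan n J' x0 (k + M * n).
    elim: k => //= k IH kn; rewrite IH; last exact: ltnW.
    congr (step _ _); apply: asbool_equiv_eq; apply: same'; rewrite mulSn; lia.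
  by apply: ext; lia.
rewrite -zn in uz.
have [->|[W [a [b [-> ->]]]]] := swapped_end (size_scan n1 _ _ _) sw2.
  by left.
case: (asboolP (J z)) => Jz; case: (asboolP (J (z + 1))) => Jz1.
- right; rewrite !step_both; split; last exact: balanced_pair.
  by right; exists [::], a.+1, b.+1, W.
- have : r <= z; last by lia.
  apply: mn; apply/lowerRP; split; last exact/unmatchedP.
  have -> : z = r + (- (m.+1)%:Z) * n%:Z by rewrite er /z /M; lia.
  by rewrite class_near // dvdz_mull.
- by left; rewrite step_rightC.
- by left; rewrite step_neitherC.
Qed.
End Signature.

(** * Crystal strings and Demazure crystals *)

Lemma charged_full J m : charged J m -> exists b, forall y, y <= b -> J y.
Proof.
move=> [b [T [_ lo _]]]; exists (b - T%:Z) => y yb.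
have -> : y = b - `|b - y|%N%:Z by lia.
by apply: lo; lia.
Qed.

Lemma charged_bound J m : charged J m -> exists b, forall y, b < y -> ~ J y.
Proof. by move=> [b [T [up _ _]]]; exists b. Qed.

Section Crystal.
Variable n : nat.
Hypothesis n1 : (1 < n)%N.
Implicit Types (i : 'I_n) (J : set int) (x r : int).

(** The elements of C(L_m), see [crystalP]. *)
Definition admissible (m : int) (J : set int) : Prop := charged J m /\ linked n J.

Lemma class_below i (b : int) : exists2 z, z <= b & in_class i z.
Proof.
exists (i%:Z - (`|b - i%:Z| * n)%:Z); first by nia.
rewrite class_dvd; have -> : i%:Z - (`|b - i%:Z| * n)%:Z - i%:Z =
  - (`|b - i%:Z|%N%:Z) * n%:Z by lia.
exact: dvdz_mull.
Qed.

Lemma class_shift i x (k : int) : in_class i x -> in_class i (x + k * n%:Z).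
Proof. by move=> cx; rewrite class_near // dvdz_mull. Qed.

Lemma lower_lowers i J m J' : charged J m -> lower i J = Some J' ->
  exists r, lowers i J r J'.
Proof.
move=> cJ; rewrite /lower; case: asboolP => // -[r0 R0] [<-].
have [b fb] := charged_full cJ.
have low r : lowerR i J r -> b < r + 1.
  move=> /(lowerRP n1)[_ /(unmatchedP n1)[_ nJ _]].
  by rewrite ltNge; apply/negP => /fb.
have ex : exists t : nat, `[< lowerR i J (b + t%:Z) >].
  exists `|r0 - b|%N; apply/asboolP; have -> : b + `|r0 - b|%N%:Z = r0 => //.
  by have := low _ R0; lia.
case: (ex_minnP ex) => t /asboolP Rt mn; exists (b + t%:Z).
have mn' r' : lowerR i J r' -> b + t%:Z <= r'.
  move=> R'; have := low _ R' => lt.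
  have := mn `|r' - b|%N; have -> : b + `|r' - b|%N%:Z = r' by lia.
  by move=> /(_ (asboolT R')); lia.
by split=> //; rewrite (zminE Rt mn').
Qed.

Lemma lowers_lower i J r J' : lowers i J r J' -> lower i J = Some J'.
Proof.
move=> [R mn ->]; rewrite /lower asboolT; last by exists r.
by rewrite (zminE R mn).
Qed.

(** The only gap that could become too long is the one left of r + 1, when J
    contains r - n but nothing else up to r; then r - n would be unmatched and
    smaller than r. *)
Lemma admissible_lowers i J r J' m : admissible m J -> lowers i J r J' ->
  admissible m J'.
Proof.
move=> [cJ w] [/(lowerRP n1)[cr ur] mn ->].
have [Jr nJr u] := (unmatchedP n1 J r).1 ur.
split; first exact: charged_swap.
move=> z /swapE[[Jz zr]|->].
  have [y [Jy yz zy]] := w _ Jz.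
  have [e|ne] := eqVneq y r; last first.
    by exists y; split=> //; apply/swapE; left; split=> //; apply/eqP.
  have zr1 : z <> r + 1 by move=> e1; apply: nJr; rewrite -e1.
  by exists (r + 1); split; [apply/swapE; right | lia | lia].
have [y [Jy yr ry]] := w _ Jr.
have [e|ne] := eqVneq y (r - n%:Z); last first.
  exists y; split; [apply/swapE; left; split=> // | |]; by lia.
have [Jn|nJn] := pselect (J (r - n%:Z + 1)).
  exists (r - n%:Z + 1); split; [apply/swapE; left; split=> // | |]; by lia.
suff /mn : lowerR i J (r - n%:Z) by lia.
apply/(lowerRP n1); split.
  by have := class_shift (-1) cr; rewrite mulN1r.
apply/(unmatchedP n1); split=> //; first by rewrite -e.
by rewrite subrK; apply: balanced_unmatched.
Qed.

(** The dangerous case is an element at r + 1 + n preceded by r + 1; balance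
    puts an element at r + n. *)
Lemma admissible_raise i J r m : admissible m J -> in_class i r ->
  J (r + 1) -> ~ J r -> balanced n J (r + n%:Z) -> admissible m (swap J (r + 1) r).
Proof.
move=> [cJ w] cr J1 nJr u; split; first exact: charged_swap.
move=> z /swapE[[Jz zr]|->].
  have [y [Jy yz zy]] := w _ Jz.
  have [e|ne] := eqVneq y (r + 1); last first.
    by exists y; split=> //; apply/swapE; left; split=> //; apply/eqP.
  have [ez|nz] := eqVneq z (r + 1 + n%:Z); last first.
    by exists r; split; [apply/swapE; right | lia | lia].
  exists (r + n%:Z); split; [apply/swapE; left; split | lia | lia]; last by lia.
  apply: (balanced_imply n1 u); have -> : r + n%:Z + 1 = z by lia.
  exact: Jz.
have [y [Jy yr ry]] := w _ J1.
have ny : y != r by apply/eqP => e; apply: nJr; rewrite -e.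
exists y; split; [apply/swapE; left; split=> // | |]; by lia.
Qed.

Lemma roof_admissible J m : admissible m J ->
  charged (roof n J) m /\ count_le J (roof n J).
Proof.
move=> [cJ w]; have [x0 up] := charged_bound cJ; have [b fb] := charged_full cJ.
pose l := `|x0 - b|%N.
have full y : y <= x0 - l%:Z -> J y.
  by move=> h; apply: fb; rewrite /l in h; lia.
have eR := roof_scan n1 up w full.
have [k [_ _ d c]] := climbs_scan n1 l up w.
by rewrite eR; split=> //; apply: c.
Qed.

Lemma imin_roof i J m z : admissible m J -> in_class i z ->
  (forall y, y < z -> J y) -> balanced n J z -> iminimal i (roof n J).
Proof.
move=> [cJ w] cz full u; have [b up] := charged_bound cJ.
pose M := `|b - z|.+1%N; pose x0 := z - 1 + (M * n)%:Z.
have ez : x0 + 1 - (M * n)%:Z = z by rewrite /x0; lia.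
have ez1 : x0 - (M * n)%:Z = z - 1 by rewrite /x0; lia.
have up0 y : x0 < y -> ~ J y.
  move=> h; apply: up; move: h; rewrite /x0 /M.
  have := leq_pmulr `|b - z|.+1%N (ltnW n1); lia.
have f0 y : y <= z - 1 -> J y by move=> h; apply: full; lia.
rewrite (roof_scan (l := (M * n)%N) n1 up0 w) ez1 //.
apply: imin_conf; rewrite ?subrK //.
by apply: (balanced_descent n1 up0); rewrite ez.
Qed.

Lemma roof_lowers i J r J' m : admissible m J -> lowers i J r J' ->
  roof n J' = roof n J \/ roof n J' = s i @` roof n J.
Proof.
move=> gJ lJ; have [cJ' w'] := admissible_lowers gJ lJ; have [cJ w] := gJ.
have [/(lowerRP n1)[cr ur] _ _] := lJ.
have [b up] := charged_bound cJ; have [b' up'] := charged_bound cJ'.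
have [c f] := charged_full cJ; have [c' f'] := charged_full cJ'.
(* The scan starts a whole number of periods above r, beyond both sets, and
   ends where both sets are full. *)
pose m0 := (`|(b - r)%R| + `|(b' - r)%R|)%N.
pose x0 := r - 1 + (m0.+1 * n)%:Z.
pose k := (`|(c - r)%R| + `|(c' - r)%R|)%N.
have mn (t : nat) : (t <= t * n)%N by apply: leq_pmulr; lia.
have up0 y : x0 < y -> ~ J y.
  move=> h; apply: up; move: h; rewrite /x0.
  by have := mn m0.+1; rewrite {1}/m0; lia.
have up0' y : x0 < y -> ~ J' y.
  move=> h; apply: up'; move: h; rewrite /x0.
  by have := mn m0.+1; rewrite {1}/m0; lia.
have er : r = x0 + 1 - (m0.+1 * n)%:Z by rewrite /x0; lia.
pose M := (m0 + k).+1.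
have eM : (M * n = m0.+1 * n + k * n)%N by rewrite -mulnDl.
have ex : x0 - (M * n)%:Z = r - 1 - (k * n)%:Z by rewrite eM /x0; lia.
have f0 y : y <= x0 - (M * n)%:Z -> J y.
  by rewrite ex => h; apply: f; move: h; have := mn k; rewrite {1}/k; lia.
have f0' y : y <= x0 - (M * n)%:Z -> J' y.
  by rewrite ex => h; apply: f'; move: h; have := mn k; rewrite {1}/k; lia.
rewrite (roof_scan n1 up0 w f0) (roof_scan n1 up0' w' f0').
rewrite (@conf_full n _ (scan n J' x0 (M * n)) J' J) //.
have [->|[sw _]] := scan_lowers n1 k lJ up0 er; first by left.
case: sw => [->|[A [x [y [B [sA -> ->]]]]]]; first by left.
move/size0nil: sA => ->; right; rewrite /= image_conf //.
have -> : x0 - (M * n)%:Z + 1 = r + (- k%:Z) * n%:Z by rewrite ex; lia.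
exact: class_shift.
Qed.

Lemma image_sK i J : s i @` (s i @` J) = J.
Proof.
apply/seteqP; split=> y; rewrite !(image_s n1) ?sK //.
Qed.

Lemma lower_iterS i k oJ :
  lower_iter i k.+1 oJ = obind (@lower n i) (lower_iter i k oJ).
Proof. by []. Qed.

Lemma lower_iter_admissible i k J0 J m : admissible m J0 ->
  lower_iter i k (Some J0) = Some J ->
  admissible m J /\ (roof n J = roof n J0 \/ roof n J = s i @` roof n J0).
Proof.
move=> g0; elim: k J => [|k IH] J; first by move=> [<-]; split=> //; left.
rewrite lower_iterS; case e: (lower_iter i k _) => [J1|] //= h.
have [g1 r1] := IH _ e; have [r lr] := lower_lowers g1.1 h.
split; first exact: admissible_lowers lr.
case: (roof_lowers g1 lr) => ->; first exact: r1.
by case: r1 => ->; [right | left; rewrite image_sK].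
Qed.

(** At r the balance is lost for the last time when going left. Moving the
    bead r + 1 back to r makes it the leftmost unmatched bead of class i: for
    r' < r the lack of balance at r' is already visible below r, where nothing
    changed, or the bead r + 1 is needed to see it, and one unit less still
    suffices. *)
Lemma lowers_raise i J r : in_class i r -> J (r + 1) -> ~ J r ->
  balanced n J (r + n%:Z) ->
  (forall t : nat, ~ balanced n J (r - (t * n)%:Z)) ->
  lowers i (swap J (r + 1) r) r J.
Proof.
move=> cr J1 nJr u nu; set J' := swap _ _ _.
have same y : y <> r -> y <> r + 1 -> J y <-> J' y.
  by move=> yr yr1; rewrite /J' swapE; split=> [Jy|[[]|]//]; left.
have nJ'1 : ~ J' (r + 1) by rewrite /J' swapE => -[[]//|]; lia.
have J'r : J' r by rewrite /J' swapE; right.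
have u' : balanced n J' (r + n%:Z).
  by apply: (balanced_ext n1 _ u) => y ry; apply: same; lia.
split.
- by apply/(lowerRP n1); split=> //; apply/(unmatchedP n1).
- move=> r' /(lowerRP n1)[cr' ur']; rewrite leNgt; apply/negP => lt.
  have [k0 ek] := class_diff n1 cr' cr.
  have k0p : 0 < k0 by nia.
  pose t := `|k0|%N; have er : r = r' + (t * n)%:Z by rewrite ek /t; lia.
  have t0 : (0 < t)%N by rewrite /t; lia.
  apply: (nu t) => l.
  have er' : r - (t * n)%:Z = r' by rewrite er; lia.
  rewrite er' leqNgt; apply/negP => gt.
  have ext l' x : (l' <= t)%N -> r' <= x <= r' + 1 ->
      period_count n J x l' = period_count n J' x l'.
    move=> lt' hx; apply: (period_count_ext n1) => s sl; apply: same.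
      by have := mulSn_le n (leq_trans sl lt'); lia.
    by have := mulSn_le n (leq_trans sl lt'); lia.
  have strict l' : (0 < l')%N ->
      (period_count n J' (r' + 1) l' < period_count n J' r' l')%N.
    by case: l' => // l' _; apply: ur'.
  have [lt'|tl] := leqP l t.
    case: l gt lt' => [|l] gt lt'; first by move: gt; rewrite !period_count0.
    by have := ur' l; rewrite -!ext //; lia.
  have el : l = (t + (l - t.+1).+1)%N by lia.
  move: gt; rewrite el !(period_countD n1) !(period_countS n1) -er.
  have -> : r' + 1 + (t * n)%:Z = r + 1 by rewrite er; lia.
  have -> : r + 1 + n%:Z = r + n%:Z + 1 by lia.
  have := u (l - t.+1)%N; rewrite (asboolT J1) (asboolF nJr).
  by have := strict t t0; rewrite -!ext //; lia.
- apply/seteqP; split=> y; rewrite /J' !swapE.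
    move=> Jy; have [->|yr] := eqVneq y (r + 1); first by right.
    left; split; last by move=> e; apply: nJr; rewrite -e.
    by left; split=> //; apply/eqP.
  by move=> [[[[]|->]//]|->].
Qed.

(** Each step that undoes a lowering operator brings the lowest known point of
    balance down by at least one period, until it reaches the part filled by
    J. *)
Lemma raise i m z0 N J : admissible m J -> (forall y, y <= z0 + 1 -> J y) ->
  in_class i z0 ->
  (exists2 t, (t <= N)%N & balanced n J (z0 + (t * n)%:Z)) ->
  exists k J0, [/\ admissible m J0, forall y, y <= z0 + 1 -> J0 y, balanced n J0 z0
    & lower_iter i k (Some J0) = Some J].
Proof.
elim: N J => [|N IH] J gJ full cz [t tN u].
  exists 0%N, J; split=> //; move: u.
  have -> : t = 0%N by lia.
  by rewrite mul0n addr0.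
have [uN|nu] := pselect (exists2 t, (t <= N)%N & balanced n J (z0 + (t * n)%:Z)).
  exact: IH.
have et : t = N.+1.
  by apply/eqP; rewrite eqn_leq tN ltnNge; apply/negP => h; apply: nu; exists t.
pose r := z0 + (N * n)%:Z.
have cr : in_class i r by rewrite /r PoszM; apply: class_shift.
have ur : balanced n J (r + n%:Z).
  by rewrite et mulSn in u; move: u; rewrite /r; congr balanced; lia.
have nur : ~ balanced n J r by move=> h; apply: nu; exists N.
have [J1 nJr] : J (r + 1) /\ ~ J r.
  split; last by move=> h; apply: nur; apply: (balanced_pair n1 ur).
  by apply: contrapT => h; apply: nur; apply: (balanced_pair n1 ur).
have rz : z0 + 1 < r by rewrite ltNge; apply/negP => /full.
have low : lowers i (swap J (r + 1) r) r J.
  apply: lowers_raise => // s us.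
  have [sN|Ns] := leqP s N.
    apply: nu; exists (N - s)%N; first by lia.
    have -> : z0 + ((N - s) * n)%:Z = r - (s * n)%:Z => //.
    by rewrite /r mulnBl; have := leq_mul sN (leqnn n); lia.
  apply: nu; exists 0%N; rewrite ?mul0n ?addr0 //.
  have key k : balanced n J (z0 - (k * n)%:Z) -> balanced n J z0.
    elim: k => [|k IHk]; first by rewrite subr0.
    move=> h; apply: IHk.
    have -> : z0 - (k * n)%:Z = z0 - (k.+1 * n)%:Z + n%:Z by rewrite mulSn; lia.
    by apply: (balanced_up n1 h) => // _; apply: full; lia.
  apply: (key (s - N)%N); have -> : z0 - ((s - N) * n)%:Z = r - (s * n)%:Z => //.
  by rewrite /r mulnBl; have := leq_mul (ltnW Ns) (leqnn n); lia.
set J' := swap J (r + 1) r in low *.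
have gJ' : admissible m J' by exact: (admissible_raise gJ cr).
have [R' _ _] := low; have [_ ur'] := (lowerRP n1 _ _ _).1 R'.
have [||k [J0 [g0 f0 u0 e0]]] := IH J' gJ' _ cz.
- by move=> y h; apply/swapE; left; split; [apply: full | lia].
- by exists N => //; apply: balanced_unmatched.
exists k.+1, J0; split=> //.
by rewrite lower_iterS e0 /=; exact: lowers_lower low.
Qed.
End Crystal.

Section Demazure.
Variable n : nat.
Hypothesis n1 : (1 < n)%N.
Implicit Types (i : 'I_n) (J : set int).

Lemma maya_L m : maya m 0 (L m) m.
Proof.
split=> [y my h|t _|]; first by have : y <= m := h; lia.
  by rewrite /L /=; lia.
by rewrite count_top0; lia.
Qed.

Lemma charged_L m : charged (L m) m.
Proof. by exists m, 0%N; apply: maya_L. Qed.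

Lemma admissible_L m : admissible n m (L m).
Proof.
split; first exact: charged_L.
move=> z zm; exists (z - 1); split; [|lia|lia].
by have : z <= m := zm; rewrite /L /=; lia.
Qed.

Lemma roof_L m : roof n (L m) = L m.
Proof.
apply: climbs_roof (climbs_refl _ _) _ => z zm.
by have : z <= m := zm; rewrite /L /=; lia.
Qed.

Lemma count_le_L J m : charged J m -> count_le J (L m) -> J = L m.
Proof.
move=> cJ [b1 d]; have [b0 h] := charged2 cJ (charged_L m).
pose b := Num.max m (Num.max b0 b1).
have mb : m <= b by rewrite le_max lexx.
have [|T0 hT] := h b; first by rewrite !le_max lexx orbT.
have {}d := d b; rewrite !le_max lexx !orbT in d; have {d} d := d isT.
pose t0 := `|b - m|%N; have et0 : b - t0%:Z = m by lia.
have L0 : count_top b (L m) t0 = 0%N.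
  by apply: count_top_empty => s st h'; have : b - s%:Z <= m := h'; lia.
have J0 : count_top b J t0 = 0%N by have := d t0; rewrite L0; lia.
have [[up lo c] [_ _ cL]] := hT (maxn T0 t0) (leq_maxl _ _).
set T := maxn T0 t0 in lo c cL.
have tT : (t0 <= T)%N by rewrite leq_maxr.
have JT : count_top b J T = (T - t0)%N by lia.
have sub y : J y -> L m y.
  move=> Jy; rewrite /L /= leNgt; apply/negP => my.
  have yb : y <= b by rewrite leNgt; apply/negP => /up.
  pose s := `|b - y|%N; have es : b - s%:Z = y by lia.
  have st : (s < t0)%N by lia.
  by have := count_top_le b J st; rewrite count_topS J0 asboolT ?es //; lia.
apply/seteqP; split=> // y my; have {}my : y <= m := my.
apply: contrapT => nJy.
pose s := `|b - y|%N; have es : b - s%:Z = y by lia.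
have [Ts|sT] := leqP T s; first by apply: nJy; rewrite -es; apply: lo.
have ub a l : (count_top a J l <= l)%N.
  by elim: l => [|l IH]; rewrite ?count_top0 // count_topS; case: asbool; lia.
have e1 : T = (t0 + ((s - t0).+1 + (T - s.+1)))%N by lia.
have := JT; rewrite {1}e1 !count_topD J0 count_topS.
have -> : b - t0%:Z - (s - t0)%N%:Z = y by lia.
rewrite asboolF //.
have := ub (b - t0%:Z - (s - t0).+1%:Z) (T - s.+1)%N.
by have := ub (b - t0%:Z) (s - t0)%N; lia.
Qed.

Definition roofed (w : int -> int) (m : int) : set (set int) :=
  [set J | admissible n m J /\ count_le (roof n J) (w @` L m)].

Lemma lower_iter_None i k : lower_iter i k None = None.
Proof.
by elim: k => //= k IH; rewrite /lower_iter /= -/(lower_iter i k None) IH.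
Qed.

Lemma demazure_cons i u m J : demazure (i :: u) m J <->
  exists k J0, demazure u m J0 /\ lower_iter i k (Some J0) = Some J.
Proof.
split=> [[ks]|[k [J0 [[ks h] e]]]].
  case/tupleP: ks => k ks /=.
  case e: (foldr _ _ _) => [J0|] h; last by rewrite lower_iter_None in h.
  by exists k, J0; split=> //; exists ks.
by exists (cons_tuple k ks); rewrite /= h.
Qed.

Lemma reduced_tail i (u : seq 'I_n) :
  reduced_word (word_act (i :: u)) (i :: u) -> reduced_word (word_act u) u.
Proof.
move=> [_ red]; split=> // v e.
have /red : word_act (i :: u) =1 word_act (i :: v) by move=> x /=; rewrite e.
by [].
Qed.

Lemma charged_word (u : seq 'I_n) m : charged (word_act u @` L m) m.
Proof.
elim: u => [|i u IH] /=; first by rewrite image_id; apply: charged_L.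
by rewrite -image_comp; apply: charged_image.
Qed.

Lemma demazure_roofed (u : seq 'I_n) m : reduced_word (word_act u) u ->
  demazure u m = roofed (word_act u) m.
Proof.
elim: u => [|i u IH] red.
  apply/seteqP; split=> J.
    move=> [ks /=]; rewrite tuple0 /= => -[<-].
    by split; [exact: admissible_L | rewrite roof_L image_id; apply: count_le_refl].
  move=> [gJ]; rewrite image_id => d; exists [tuple] => /=; congr Some.
  apply/esym/count_le_L; first exact: gJ.1.
  by have [_ d'] := roof_admissible n1 gJ; apply: count_le_trans d' d.
have {}IH := IH (reduced_tail red).
have mS : iminimal i (word_act u @` L m) := reduced_imin n1 red.
set S := word_act u @` L m in mS; have cS : charged S m := charged_word u m.
have eS : word_act (i :: u) @` L m = s i @` S by rewrite /= -image_comp.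
have sat K : charged K m -> count_le K (s i @` S) ->
    count_le (s i @` K) (s i @` S).
  by move=> cK dK; apply: (count_le_imax n1 cK dK (imax_image n1 mS)).
apply/seteqP; split=> J.
  move=> /demazure_cons[k [J0 []]]; rewrite IH => -[g0 d0].
  move=> /(lower_iter_admissible n1 g0)[gJ r].
  split=> //; rewrite eS; have [c0 _] := roof_admissible n1 g0.
  have d1 : count_le (roof n J0) (s i @` S).
    exact: count_le_trans d0 (count_le_image n1 cS mS).
  by case: r => ->; [exact: d1 | apply: sat].
move=> [gJ]; rewrite eS => dJ; apply/demazure_cons; rewrite IH.
have [b fb] := charged_full gJ.1; have [z0 z0b cz] := class_below n1 i (b - 1).
have full y : y <= z0 + 1 -> J y by move=> h; apply: fb; lia.
have [x0 up] := charged_bound gJ.1.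
(* Balance is trivial above all elements of J. *)
have [N uN] : exists N, balanced n J (z0 + (N * n)%:Z).
  exists `|x0 - z0|.+1%N => l; rewrite [X in (X <= _)%N](_ : _ = 0%N) //.
  apply: big1 => t _; rewrite asboolF //; apply: up.
  by have := leq_pmulr `|x0 - z0|.+1%N (ltnW n1); lia.
have [|k [J0 [g0 f0 u0 e]]] := @raise n n1 i m z0 N J gJ full cz; first by exists N.
exists k, J0; split=> //; split=> //.
have [_ r] := lower_iter_admissible n1 g0 e.
have [c0 _] := roof_admissible n1 g0; have [cJ _] := roof_admissible n1 gJ.
have d0 : count_le (roof n J0) (s i @` S).
  case: r => r; first by rewrite -r.
  by rewrite -(image_sK n1 i (roof n J0)) -r; apply: sat.
apply: (count_le_lift n1 cS d0 _ mS).
by apply: (imin_roof n1 g0 cz _ u0) => y h; apply: f0; lia.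
Qed.
End Demazure.

Theorem theorem1 (n : nat) (hn : (2 <= n)%N) (m : int)
    (w : int -> int) (hw : weyl n w)
    (u : seq 'I_n) (hu : reduced_word w u) :
  demazure u m =
    [set J | crystal n m J /\ bruhat_le (roof n J) (w @` L m)].
Proof.
have ew : w = word_act u by apply/funext; exact: hu.1.
rewrite ew in hu *; rewrite (demazure_roofed hn m hu).
have cw := charged_word hn u m.
apply/seteqP; split=> J [gJ le].
  have [cR _] := roof_admissible hn gJ.
  by split; [apply/crystalP | apply/(bruhat_count_le cR cw)].
have gJ' : admissible n m J by apply/crystalP.
have [cR _] := roof_admissible hn gJ'.
by split=> //; apply/(bruhat_count_le cR cw).
Qed.
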